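(* Let $(m,n)$ be an admissible couple of positive integers, and let $\mathbf{Q}=\mathbf{Q}_{m,n}: C^\infty(\mathbb{S}^n)\to C^\infty(\mathbb{S}^n)$ be the conformal $Q$-curvature increment operator on the standard sphere $(\mathbb{S}^n,g_0)$. Then the local image of $\mathbf{Q}$ near $0$ admits no scalar constraint; that is, there exists no real-valued submersion $K$ defined on a neighborhood of $0$ in $C^\infty(\mathbb{S}^n)$ such that $K\circ\mathbf{Q}=0$ on some neighborhood of $0$ in $C^\infty(\mathbb{S}^n)$.
   Context: A couple of positive integers $(m,n)$ is called admissible if $n>1$, and $n\ge 2m$ in case $n$ is even. $(\mathbb{S}^n,g_0)$ is the standard round unit $n$-sphere, functions are real-valued and smooth, and $\Delta_0$ is the positive Laplacian of $g_0$. For $u\in C^\infty(\mathbb{S}^n)$ set $g_u=e^{2u}g_0$. Define the Paneitz--Branson operator of $g_0$ by $$P_0=\prod_{k=1}^m\left[\Delta_0+\left(\tfrac n2-k\right)\left(\tfrac n2+k-1\right)\right].$$ Case $n=2m$: $Q_0=Q(g_0)=(2m-1)!$, $\;Q(g_u)=e^{-2mu}(Q_0+P_0[u])$, and the $Q$-curvature increment operator is $\mathbf{Q}[u]=Q(g_u)-Q_0$. Case $n\ne 2m$: $P_u(\cdot)=e^{-(\frac n2+m)u}P_0\left[e^{(\frac n2-m)u}\,\cdot\,\right]$, the $Q$-curvature $Q(g_u)$ is defined by $\left(\frac n2-m\right)Q(g_u)=P_u(1)$, $Q_0=Q(g_0)$, and the (renormalized) $Q$-curvature increment operator is $\mathbf{Q}[u]=\left(\frac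 n2-m\right)\left[Q(g_u)-Q_0\right]$. In both cases $\mathbf{Q}[0]=0$. The space $C^\infty(\mathbb{S}^n)$ carries its usual Fréchet topology, all maps are taken smooth (in the Fréchet sense), and a real-valued submersion is a smooth real-valued map whose differential at each point of its domain is onto $\mathbb{R}$, i.e. nonzero. *)

(* Defs.v *)
From HB Require Import structures.
From mathcomp Require Import all_boot all_order all_algebra.
From mathcomp Require Import all_classical all_reals all_analysis.
From mathcomp Require Import ring.

Set Implicit Arguments.
Unset Strict Implicit.
Unset Printing Implicit Defensive.
Import Order.TTheory GRing.Theory Num.Theory.
Import numFieldNormedType.Exports.
Local Open Scope classical_set_scope.
Local Open Scope ring_scope.

Section smooth_on.
Context {R : realType} {N : nat}.
Implicit Types (F G : 'rV[R]_N -> R) (Om : set 'rV[R]_N) (i : 'I_N).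

Definition basis_vec (i : 'I_N) : 'rV[R]_N := delta_mx 0 i.

Definition pderiv (i : 'I_N) (F : 'rV[R]_N -> R) : 'rV[R]_N -> R :=
  fun x => 'D_(basis_vec i) F x.

(* Iterated partial derivatives of every order exist and are continuous on [Om];
   meant for open [Om]. *)
Definition smooth_on (Om : set 'rV[R]_N) (F : 'rV[R]_N -> R) : Prop :=
  forall s : seq 'I_N, let G := foldr pderiv F s in
  forall x, Om x ->
    {for x, continuous G} /\ forall i, derivable G x (basis_vec i).

(* Recursive form of the same notion, bounded in order, for the closure proofs. *)
Fixpoint Ck (k : nat) Om F : Prop :=
  (forall x, Om x ->
    {for x, continuous F} /\ forall i, derivable F x (basis_vec i)) /\
  if k is k'.+1 then forall i, Ck k' Om (pderiv i F) else True.

Lemma smooth_onP Om F : smooth_on Om F <-> forall k, Ck k Om F.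
Proof.
split.
  move=> + k; elim: k F => [|k IH] F sF /=; first by split=> //; exact: (sF [::]).
  split; first exact: (sF [::]).
  by move=> i; apply: IH => s; have := sF (rcons s i); rewrite foldr_rcons.
move=> cF s; have {cF} := cF (size s); elim/last_ind: s F => [|s i IH] F /=.
  by case.
by rewrite size_rcons foldr_rcons => -[_ /(_ i)/IH].
Qed.

Lemma CkW k Om F : Ck k.+1 Om F -> Ck k Om F.
Proof.
elim: k F => [|k IH] F [h1 h2]; first by split.
by split=> // i; apply: IH; exact: h2.
Qed.

Lemma eq_Ck k Om F G : open Om -> (forall x, Om x -> F x = G x) ->
  Ck k Om F -> Ck k Om G.
Proof.
move=> oO; have nO x : Om x -> \forall y \near x, Om y.
  by move=> Ox; apply: open_nbhs_nbhs; split.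
have step F' G' : (forall x, Om x -> F' x = G' x) ->
  (forall x, Om x ->
    {for x, continuous F'} /\ forall i, derivable F' x (basis_vec i)) ->
  (forall x, Om x ->
    {for x, continuous G'} /\ forall i, derivable G' x (basis_vec i)).
  move=> e h x Ox; have [c d] := h x Ox.
  have ne : {near x, F' =1 G'} by apply: filterS (nO x Ox) => y /e.
  split; last by move=> i; apply: near_eq_derivable ne (d i).
  change (G' @ x --> G' x); rewrite -(e _ Ox).
  by apply: (cvg_trans _ c); exact: near_eq_cvg ne.
elim: k F G => [|k IH] F G e [h1 h2]; split=> //; try exact: step h1.
move=> i; apply: IH (h2 i) => x Ox; apply: near_eq_derive.
by apply: filterS (nO x Ox) => y /e.
Qed.

Lemma Ck_cst k Om (c : R) : Ck k Om (fun=> c).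
Proof.
elim: k c => [|k IH] c; split=> //.
- by move=> x _; split; [exact: cst_continuous | move=> i; exact: derivable_cst].
- by move=> x _; split; [exact: cst_continuous | move=> i; exact: derivable_cst].
move=> i; rewrite (_ : pderiv _ _ = fun=> 0) //.
by apply/funext => x; exact: derive_cst.
Qed.

Lemma CkD k Om F G : open Om -> Ck k Om F -> Ck k Om G -> Ck k Om (F \+ G).
Proof.
move=> oO; elim: k F G => [|k IH] F G [f1 f2] [g1 g2]; split => //.
- move=> x Ox; have [cF dF] := f1 x Ox; have [cG dG] := g1 x Ox.
  split; first exact: continuousD.
  by move=> i; exact: derivableD.
- move=> x Ox; have [cF dF] := f1 x Ox; have [cG dG] := g1 x Ox.
  split; first exact: continuousD.
  by move=> i; exact: derivableD.
move=> i; apply: (@eq_Ck _ _ (pderiv i F \+ pderiv i G)) => //; last by apply: IH; [exact: f2|exact: g2].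
move=> x Ox; have [cF dF] := f1 x Ox; have [cG dG] := g1 x Ox.
by rewrite /pderiv /= -deriveD.
Qed.

Lemma CkM k Om F G : open Om -> Ck k Om F -> Ck k Om G -> Ck k Om (F \* G).
Proof.
move=> oO; elim: k F G => [|k IH] F G [f1 f2] [g1 g2].
  split => //; move=> x Ox; have [cF dF] := f1 x Ox; have [cG dG] := g1 x Ox.
  split; first exact: continuousM.
  by move=> i; exact: derivableM.
split.
  move=> x Ox; have [cF dF] := f1 x Ox; have [cG dG] := g1 x Ox.
  split; first exact: continuousM.
  by move=> i; exact: derivableM.
move=> i; apply: (@eq_Ck _ _ ((F \* pderiv i G) \+ (G \* pderiv i F))) => //.
  move=> x Ox; have [cF dF] := f1 x Ox; have [cG dG] := g1 x Ox.
  by rewrite /pderiv /= deriveM.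
by apply: CkD => //; apply: IH; [apply: CkW; split|exact: g2|apply: CkW; split|
  exact: f2].
Qed.

Lemma is_derive_comp (f : 'rV[R]_N -> R) (g : R -> R) x v (dg : R) :
  derivable f x v -> is_derive (f x) 1 g dg ->
  is_derive x v (g \o f) (dg * 'D_v f x).
Proof.
move=> df [dg1 dg2].
have e (h : 'rV[R]_N -> R) : 'D_v h x = (fun t : R => h (t *: v + x))^`()%classic 0.
  rewrite derive1E /derive; set g1 := fun t => t^-1 *: _.
  set g2 := fun t => t^-1 *: _; suff -> : g1 = g2 by [].
  by apply/funext => t; rewrite /g1 /g2 /= addr0 scale0r add0r [t%:A]mulr1.
have d0 := (derivable1P f x v).1 df.
have f0 : f (0 *: v + x) = f x by rewrite scale0r add0r.
apply: DeriveDef.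
  apply/derivable1P; apply/derivable1_diffP.
  apply: (@differentiable_comp _ _ _ _ (fun t : R => f (t *: v + x)) g).
    exact/derivable1_diffP.
  by rewrite f0; exact/derivable1_diffP.
rewrite !e (derive1_comp (f := fun t : R => f (t *: v + x)) (g := g)) //.
  by rewrite f0 derive1E dg2.
by rewrite f0.
Qed.

Lemma Ck_exp k Om F : open Om -> Ck k Om F -> Ck k Om (fun x => expR (F x)).
Proof.
move=> oO; have base F' : (forall x, Om x ->
    {for x, continuous F'} /\ forall i, derivable F' x (basis_vec i)) ->
  (forall x, Om x ->
    {for x, continuous (fun x => expR (F' x))} /\
    forall i, derivable (fun x => expR (F' x)) x (basis_vec i)).
  move=> h x Ox; have [cF dF] := h x Ox; split.
    by apply: continuous_comp cF _; exact: continuous_expR.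
  by move=> i; have [] := is_derive_comp (dF i) (is_derive_expR (F' x)).
elim: k F => [|k IH] F [f1 f2]; split; rewrite ?[if _ then _ else _]/=//;
  try exact: base.
move=> i; apply: (@eq_Ck _ _ ((fun x => expR (F x)) \* pderiv i F)) => //.
  move=> x Ox; have [cF dF] := f1 x Ox.
  by have [_ e] := is_derive_comp (dF i) (is_derive_expR (F x)); exact/esym.
by apply: CkM => //; [apply: IH; apply: CkW; split|exact: f2].
Qed.

End smooth_on.

Section euclid.
Context {R : realType} {N : nat}.
Implicit Types (x y : 'rV[R]_N) (i : 'I_N).

(* The library norm of ['rV_N] is the sup norm. *)
Definition enorm (x : 'rV[R]_N) : R := Num.sqrt (\sum_i x 0 i ^+ 2).

Definition punctured : set 'rV[R]_N := [set x | x != 0].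

Lemma punctured_open : open punctured.
Proof.
rewrite (_ : punctured = ~` [set 0]); last first.
  by apply/seteqP; split => x /= /eqP.
by apply: closed_openC; apply: accessible_closed_set1;
  apply: hausdorff_accessible; exact: norm_hausdorff.
Qed.

Lemma sqsum_gt0 x : x != 0 -> 0 < \sum_i x 0 i ^+ 2.
Proof.
move=> x0; rewrite lt_neqAle sumr_ge0 ?andbT; last by move=> *; exact: sqr_ge0.
apply: contra x0 => /eqP/esym/eqP.
rewrite psumr_eq0; last by move=> *; exact: sqr_ge0.
move=> /allP h; apply/eqP/rowP => i; rewrite mxE; apply/eqP.
by rewrite -sqrf_eq0; apply: (implyP (h i (mem_index_enum i))).
Qed.

Lemma enorm_gt0 x : x != 0 -> 0 < enorm x.
Proof. by move=> x0; rewrite sqrtr_gt0; exact: sqsum_gt0. Qed.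

Lemma enormZ (c : R) x : 0 <= c -> enorm (c *: x) = c * enorm x.
Proof.
move=> c0; rewrite /enorm -[c in RHS]ger0_norm// -sqrtr_sqr -sqrtrM ?sqr_ge0//.
by rewrite mulr_sumr; congr Num.sqrt; apply: eq_bigr => i _; rewrite mxE exprMn.
Qed.

Lemma enorm_basis_vec i : enorm (basis_vec i) = 1.
Proof.
rewrite /enorm (bigD1 i)//= big1 => [|j ji].
  by rewrite mxE !eqxx addr0 expr1n sqrtr1.
by rewrite mxE eqxx (negbTE ji) expr0n.
Qed.

Lemma Ck_coord k Om i : Ck k Om (fun x : 'rV[R]_N => x 0 i).
Proof.
have d x v : is_derive x v (fun x : 'rV[R]_N => x 0 i) (v 0 i).
  apply: DeriveDef; first exact/diff_derivable/differentiable_coord.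
  rewrite deriveE; last exact: differentiable_coord.
  have @f : {linear 'rV[R]_N -> R}.
    by exists (fun y : 'rV[R]_N => y 0 i); do 2![eexists]; do ?[constructor];
      rewrite ?mxE// => ? *; rewrite ?mxE//; move=> ?; rewrite !mxE.
  rewrite (_ : (fun x : 'rV[R]_N => x 0 i) = f) //.
  by rewrite diff_lin //; exact: coord_continuous.
have b x : Om x -> {for x, continuous (fun x : 'rV[R]_N => x 0 i)} /\
   forall j, derivable (fun x : 'rV[R]_N => x 0 i) x (basis_vec j).
  move=> _; split; first exact: coord_continuous.
  by move=> j; have [] := d x (basis_vec j).
case: k => [|k]; split => // j.
rewrite (_ : pderiv _ _ = fun=> (basis_vec j : 'rV[R]_N) 0 i).
  exact: Ck_cst.
by apply/funext => x; have [] := d x (basis_vec j).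
Qed.

Lemma Ck_sqsum k Om : open Om -> Ck k Om (fun x : 'rV[R]_N => \sum_i x 0 i ^+ 2).
Proof.
move=> oO; elim: (index_enum _) => [|i s IH].
  by under eq_fun do rewrite big_nil; exact: Ck_cst.
under eq_fun do rewrite big_cons expr2.
by apply: CkD => //; apply: CkM => //; exact: Ck_coord.
Qed.

Lemma is_derive_sqrtV (r : R) : 0 < r ->
  is_derive r 1 (fun s : R => (Num.sqrt s)^-1) (- 2^-1 * (Num.sqrt r)^-1 ^+ 3).
Proof.
move=> r0; have [d e] := is_derive1_sqrt r0.
have s0 : Num.sqrt r != 0 by rewrite gt_eqF // sqrtr_gt0.
apply: DeriveDef; first exact: derivableV.
rewrite deriveV // e; move: (Num.sqrt r) s0 => s s0.
change (- s ^- 2 * (2 * s)^-1 = - 2^-1 * s^-1 ^+ 3).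
by field.
Qed.

Lemma Ck_enormV k : Ck k punctured (fun x : 'rV[R]_N => (enorm x)^-1).
Proof.
have oO := punctured_open.
pose q (x : 'rV[R]_N) := \sum_i x 0 i ^+ 2.
have qS j : Ck j punctured q by exact: Ck_sqsum.
have qd x i : x != 0 -> derivable q x (basis_vec i).
  by move=> x0; have [h _] := qS 0%N; have [_] := h x x0.
have d x i : x != 0 -> is_derive x (basis_vec i) (fun x => (enorm x)^-1)
    (- 2^-1 * (enorm x)^-1 ^+ 3 * pderiv i q x).
  move=> x0; have := is_derive_comp (qd x i x0) (is_derive_sqrtV (sqsum_gt0 x0)).
  by [].
have b x : punctured x -> {for x, continuous (fun x : 'rV[R]_N => (enorm x)^-1)}
    /\ forall i, derivable (fun x : 'rV[R]_N => (enorm x)^-1) x (basis_vec i).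
  move=> x0; split; last by move=> i; have [] := d x i x0.
  apply: continuousV; first by rewrite gt_eqF // enorm_gt0.
  have [h _] := qS 0%N; have [cq _] := h x x0.
  by apply: continuous_comp cq _; exact: sqrt_continuous.
elim: k => [|k IH]; split => // i.
apply: (@eq_Ck _ _ _ _ ((fun=> - 2^-1) \* ((fun x => (enorm x)^-1) \*
   ((fun x => (enorm x)^-1) \* (fun x => (enorm x)^-1))) \* pderiv i q)) => //.
  move=> x x0; have [_ e] := d x i x0.
  by rewrite /= -[RHS]/('D_(basis_vec i) _ x) e /= !exprS expr0 mulr1.
do !apply: CkM => //; first exact: Ck_cst.
by have [_] := qS k.+1; apply.
Qed.

Lemma Ck_enorm k : Ck k punctured (@enorm : 'rV[R]_N -> R).
Proof.
have oO := punctured_open.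
apply: (eq_Ck oO _ (CkM oO (Ck_sqsum k oO) (Ck_enormV k))) => x x0 /=.
have q0 := sqsum_gt0 x0; rewrite /enorm.
rewrite -[X in X / _](@sqr_sqrtr _ (\sum_i _)) ?ltW // expr2 mulfK //.
by rewrite gt_eqF // sqrtr_gt0.
Qed.

End euclid.

Section sphere.
Context {R : realType} {n : nat}.

(* The round n-sphere, with the metric induced by the Euclidean R^(n+1); its
   tangent space at p is the orthogonal complement of p. *)
Definition sphere := {x : 'rV[R]_n.+1 | enorm x == 1}.

Definition pole : sphere := exist _ (basis_vec ord0) (introT eqP (enorm_basis_vec ord0)).

(* x |-> x / |x|, with the junk value [pole] at x = 0. *)
Definition radial_proj (x : 'rV[R]_n.+1) : sphere :=
  insubd pole ((enorm x)^-1 *: x).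

(* Extension of f to a function constant along rays.  As x |-> x / |x| is a smooth
   retraction of the punctured space onto the sphere, f is smooth on the
   submanifold iff [rext f] is smooth away from 0. *)
Definition rext (f : sphere -> R) : 'rV[R]_n.+1 -> R := f \o radial_proj.

Definition smooth_sphere (f : sphere -> R) : Prop := smooth_on punctured (rext f).

(* Since x |-> x / |x| has differential the tangential projection pi_p at a point p
   of the sphere, this is the intrinsic derivative df_p(pi_p e_i), that is the
   i-th ambient component of the Riemannian gradient of f at p.  The fields
   pi e_i span all the tangent spaces. *)
Definition tpartial (i : 'I_n.+1) (f : sphere -> R) : sphere -> R :=
  fun p => 'D_(basis_vec i) (rext f) (val p).

Lemma radial_projE x : x != 0 -> val (radial_proj x) = (enorm x)^-1 *: x.
Proof.
move=> x0; rewrite val_insubd enormZ ?invr_ge0 ?sqrtr_ge0 //.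
by rewrite mulVf ?eqxx // gt_eqF // enorm_gt0.
Qed.

Lemma radial_projZ (c : R) x : 0 < c -> radial_proj (c *: x) = radial_proj x.
Proof.
move=> c0; rewrite /radial_proj enormZ ?ltW // invfM scalerA mulrAC.
by rewrite mulVf ?mul1r // gt_eqF.
Qed.

Lemma pderiv_rextZ f i (c : R) x : 0 < c -> derivable (rext f) x (basis_vec i) ->
  pderiv i (rext f) (c *: x) = c^-1 * pderiv i (rext f) x.
Proof.
move=> c0 df; rewrite /pderiv; set v := basis_vec i.
have e y : 'D_v (rext f) y = (fun t : R => rext f (t *: v + y))^`()%classic 0.
  rewrite derive1E /derive; set g1 := fun t => t^-1 *: _.
  set g2 := fun t => t^-1 *: _; suff -> : g1 = g2 by [].
  by apply/funext => t; rewrite /g1 /g2 /= addr0 scale0r add0r [t%:A]mulr1.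
have d0 := (derivable1P (rext f) x v).1 df.
rewrite !e (_ : (fun t : R => rext f (t *: v + c *: x)) =
  (fun t : R => rext f (t *: v + x)) \o (fun t : R => c^-1 * t)); last first.
  apply/funext => t /=; rewrite /rext /= -(radial_projZ (c^-1 * t *: v + x) c0).
  by rewrite scalerDr scalerA mulrA mulfV ?gt_eqF // mul1r.
have dl : is_derive (0 : R) 1 (fun t : R => c^-1 * t) c^-1.
  have -> : (fun t : R => c^-1 * t) = c^-1 \*: (id : R -> R) by [].
  by apply: is_derive_eq; rewrite [LHS]mulr1.
have [dl1 dl2] := dl.
rewrite (derive1_comp (f := fun t : R => c^-1 * t)
  (g := fun t : R => rext f (t *: v + x))) ?mulr0 //.
by rewrite [X in _ * X]derive1E dl2 mulrC.
Qed.

Lemma smooth_tpartial i f : smooth_sphere f -> smooth_sphere (tpartial i f).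
Proof.
move=> sf; have oO := @punctured_open R n.+1.
apply/smooth_onP => k; have /smooth_onP/(_ k.+1) [f1 f2] := sf.
apply: (eq_Ck oO _ (CkM oO (Ck_enorm k) (f2 i))) => x x0.
have [_ d] := f1 x x0.
rewrite /rext /= /tpartial radial_projE // -/(pderiv i (rext f) _).
by rewrite pderiv_rextZ ?invrK // invr_gt0 enorm_gt0.
Qed.

Lemma smooth_cst c : smooth_sphere (fun=> c).
Proof. by apply/smooth_onP => k; exact: Ck_cst. Qed.

Lemma smooth_add f g :
  smooth_sphere f -> smooth_sphere g -> smooth_sphere (f \+ g).
Proof.
move=> /smooth_onP sf /smooth_onP sg; apply/smooth_onP => k.
exact: (CkD punctured_open (sf k) (sg k)).
Qed.

Lemma smooth_mul f g :
  smooth_sphere f -> smooth_sphere g -> smooth_sphere (f \* g).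
Proof.
move=> /smooth_onP sf /smooth_onP sg; apply/smooth_onP => k.
exact: (CkM punctured_open (sf k) (sg k)).
Qed.

Lemma smooth_exp f : smooth_sphere f -> smooth_sphere (fun p => expR (f p)).
Proof.
move=> /smooth_onP sf; apply/smooth_onP => k.
exact: (Ck_exp punctured_open (sf k)).
Qed.

End sphere.
Arguments sphere : clear implicits.

Section smooth_functions.
Context (R : realType) (n : nat).

(* [R^o] is [R] seen as a module over itself, so that [sphere R n -> R^o] is an
   [lmodType R]. *)
Definition smooth_pred : {pred (sphere R n -> R^o)} :=
  [pred f | `[< smooth_sphere f >]].

Record Csmooth := MkCsmooth {
  csmooth_fun :> sphere R n -> R^o ;
  csmoothP : csmooth_fun \in smooth_pred }.

HB.instance Definition _ := [isSub for csmooth_fun].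
HB.instance Definition _ := [Choice of Csmooth by <:].

Fact smooth_submod_closed : submod_closed smooth_pred.
Proof.
split; first by apply/asboolP; exact: smooth_cst.
move=> c f g /asboolP sf /asboolP sg; apply/asboolP.
exact: (smooth_add (smooth_mul (smooth_cst c) sf) sg).
Qed.

HB.instance Definition _ := GRing.isSubmodClosed.Build R (sphere R n -> R^o)
  smooth_pred smooth_submod_closed.
HB.instance Definition _ := [SubChoice_isSubLmodule of Csmooth by <:].

(* The Frechet topology: uniform convergence on the sphere of all the iterated
   tangential derivatives (including the empty word, i.e. f itself). *)
Definition jet (f : Csmooth) :
    {ptws seq 'I_n.+1 -> {uniform sphere R n -> R}} :=
  fun s => foldr tpartial (f : sphere R n -> R) s.

HB.instance Definition _ := Uniform.copy Csmooth (initial_topology jet).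

End smooth_functions.

Section operators.
Context {R : realType} {n : nat}.
Local Notation C := (Csmooth R n).
Implicit Types u v : C.

Lemma csmooth_smooth u : smooth_sphere u.
Proof. by have /asboolP := csmoothP u. Qed.

Definition of_smooth (f : sphere R n -> R) (sf : smooth_sphere f) : C :=
  @MkCsmooth R n f (asboolT sf).

Definition csmooth_cst (c : R) : C := of_smooth (smooth_cst c).

Definition csmooth_mul u v : C :=
  of_smooth (smooth_mul (csmooth_smooth u) (csmooth_smooth v)).

Definition csmooth_exp u : C := of_smooth (smooth_exp (csmooth_smooth u)).

Definition tderiv (i : 'I_n.+1) u : C :=
  of_smooth (smooth_tpartial i (csmooth_smooth u)).

(* Vector fields are given by their n + 1 components in R^(n+1). *)
Definition grad u : 'I_n.+1 -> C := fun i => tderiv i u.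

(* For a tangent field X, the trace of v |-> pi_p (D_v X) on the tangent space at p,
   where pi_p o D is the Levi-Civita connection of the induced metric: it equals
   the sum over i of < D_(pi_p e_i) X, e_i >. *)
Definition divergence (X : 'I_n.+1 -> C) : C := \sum_i tderiv i (X i).

Definition laplacian u : C := - divergence (grad u).

(* The factors commute, so the order of composition is irrelevant. *)
Definition paneitz0 (m : nat) : C -> C :=
  \big[(fun A B : C -> C => A \o B)/id]_(1 <= k < m.+1)
    (fun u => laplacian u +
      ((n%:R / 2 - k%:R) * (n%:R / 2 + k%:R - 1)) *: u).

(* P_u, for the metric e^(2u) g_0 *)
Definition paneitz (m : nat) u v : C :=
  csmooth_mul (csmooth_exp (- (n%:R / 2 + m%:R) *: u))
       (paneitz0 m (csmooth_mul (csmooth_exp ((n%:R / 2 - m%:R) *: u)) v)).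

(* Q(g_u); the second branch solves (n/2 - m) Q(g_u) = P_u(1). *)
Definition Qcurv (m : nat) u : C :=
  if n == m.*2 then
    csmooth_mul (csmooth_exp (- (m.*2)%:R *: u))
         (csmooth_cst ((m.*2).-1`!)%:R + paneitz0 m u)
  else (n%:R / 2 - m%:R)^-1 *: paneitz m u (csmooth_cst 1).

Definition Qincr (m : nat) u : C :=
  if n == m.*2 then Qcurv m u - csmooth_cst ((m.*2).-1`!)%:R
  else (n%:R / 2 - m%:R) *: (Qcurv m u - Qcurv m 0).

End operators.

Definition admissible (m n : nat) : Prop :=
  [/\ (0 < m)%N, (1 < n)%N & ~~ odd n -> (m.*2 <= n)%N].

Section frechet_calculus.
Context {R : realType} {E : preTopologicalLmodType R}.

Definition gateaux (h : E) (K : E -> R) : E -> R :=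
  fun u => (fun t : R => K (u + t *: h))^`()%classic 0.

(* D^k K (u){h_1, ..., h_k} *)
Definition iter_gateaux (K : E -> R) (k : nat) (h : 'I_k -> E) : E -> R :=
  foldr gateaux K [seq h i | i <- enum 'I_k].

(* Smoothness in the sense of Hamilton and Michal-Bastiani: all the iterated
   directional derivatives exist on U and are jointly continuous in
   (u, h_1, ..., h_k) at the points of U x E^k.  [K] is total, but only its
   restriction to the open set [U] matters. *)
Definition frechet_smooth_on (U : set E) (K : E -> R) : Prop :=
  forall (k : nat) (u : E) (h : {ptws 'I_k -> E}), U u ->
    {for (u, h), continuous
       (fun p : E * {ptws 'I_k -> E} => iter_gateaux K p.2 p.1)} /\
    forall v : E, derivable (fun t : R => iter_gateaux K h (u + t *: v)) 0 1.

Definition submersion_on (U : set E) (K : E -> R) : Prop :=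
  [/\ open U, frechet_smooth_on U K &
      forall u, U u -> exists h, gateaux h K u != 0].

End frechet_calculus.

(* Main.v *)
Require Import Defs.
From HB Require Import structures.
From mathcomp Require Import all_boot all_order all_algebra.
From mathcomp Require Import all_classical all_reals all_analysis.
From mathcomp Require Import ring lra zify.
Set Implicit Arguments.
Unset Strict Implicit.
Unset Printing Implicit Defensive.
Import Order.TTheory GRing.Theory Num.Theory.
Import numFieldNormedType.Exports.
Local Open Scope classical_set_scope.
Local Open Scope ring_scope.

(** Suppose that a submersion K kills the image of Q near 0.  Its differential l
    at 0 is a continuous linear functional on C^oo(S^n), and l is not zero.  The
    proof shows that l vanishes on the restrictions of polynomials to the sphere;
    these are dense, so l = 0, a contradiction.

    Both cases of the definition of Q have one form, [Qgen]: with a = n/2 + m and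
    b = n/2 - m,
<<
      Q u = e^(- a u) (kappa + beta P_0(E u)) - kappa
>>
    where E u = (e^(b u) - 1) / b, kappa = Lam_0, beta = b if n <> 2m, and
    E u = u, kappa = (2m-1)!, beta = 1 if n = 2m.  Here Lam_k is the eigenvalue
    of P_0 on spherical harmonics of degree k.  The recursion
    Lam_(k+1) (k + b) = Lam_k (k + a) and admissibility make |Lam_k| strictly
    increasing, so that the Lam_k are pairwise distinct ([Lam_inj]).  Moreover
    a kappa = beta Lam_1, so the linearization of Q at 0 is
    L = beta (P_0 - Lam_1), whose kernel consists of the harmonics of degree 1:
    their gradients are conformal vector fields.

    First order.  Differentiating K(Q(t h)) = 0 at t = 0 gives l(L h) = 0 for all
    h ([constraint_first_order]).  On polynomials of degree k, P_0 is Lam_k up to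
    terms of smaller degree, so l vanishes in degree k as soon as it does in
    smaller degrees ([l_top]), except for k = 1, where L gives nothing.

    Second order.  Let L v = 0, and let M_t be the derivative of Q at t v in the
    direction h.  Then DK(Q(t v)) M_t = 0.  As Q(t v) = o(t), DK(Q(t v)) differs
    from l by o(t) only, and differentiation at t = 0 shows that l kills the
    derivative of M_t at 0 ([constraint_second_order]).  With v = x_j and
    h = x_i x_j, i <> j, the product v h is a harmonic of degree 3, on which l
    vanishes, plus x_i / (n+3), and the relation becomes
    beta a (Lam_0 - Lam_2) l(x_i) / (n+3) = 0; hence l(x_i) = 0 ([l_coord]).

    Density ([polynomials_dense]).  The function |x|^k f(x/|x|) is of class
    C^(k-2) on the whole of R^(n+1), so it is approximated on the cube
    [-1,1]^(n+1), with its derivatives, by its Bernstein polynomials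
    ([bernstein_Ck]).  A tangential derivative on the sphere is an ambient partial
    derivative minus its radial part, and Euler's relation expresses the radial
    part through partial derivatives, so the convergence passes to the tangential
    derivatives.

    The differential calculus in C^oo(S^n) is done along curves and filters: [scvg]
    is uniform convergence of all the tangential derivatives, which is stable under
    products, exponentials and P_0, and implies convergence in the Frechet
    topology. *)

(** * Compactness of the sphere *)

Section box.
Context {R : realType} {N : nat}.

Definition box (c : R) : set 'rV[R]_N := [set x | forall i, `|x 0 i| <= c].

Lemma compact_box c : compact (box c).
Proof.
rewrite (_ : box c = [set v : 'rV[R]_N | forall i, `[- c, c]%classic (v ord0 i)]).
  by apply: (rV_compact (A := fun=> `[- c, c]%classic)) => _; exact: segment_compact.
by apply/seteqP; split => x /= h i; have := h i; rewrite in_itv /= ler_norml.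
Qed.

Lemma enorm1_box (x : 'rV[R]_N) : enorm x = 1 -> box 1 x.
Proof.
move=> e i; have s0 : 0 <= \sum_i x 0 i ^+ 2 by apply: sumr_ge0 => *; exact: sqr_ge0.
rewrite -(@ler_pXn2r _ 2) ?nnegrE // real_normK ?num_real // expr1n.
rewrite -[leRHS](expr1n _ 2) -e sqr_sqrtr // (bigD1 i) //= lerDl.
by apply: sumr_ge0 => *; exact: sqr_ge0.
Qed.

Lemma compact_enorm1 : compact [set x : 'rV[R]_N | enorm x = 1].
Proof.
apply: (@subclosed_compact _ _ (box 1)); [|exact: compact_box|
  by move=> x; exact: enorm1_box].
pose q (x : 'rV[R]_N) := \sum_i x 0 i ^+ 2.
rewrite (_ : [set x | _] = q @^-1` [set 1]).
  apply: preimage_closed; last exact: closed_eq.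
  by move=> x; have [] := (Ck_sqsum 0 openT).1 x I.
apply/seteqP; split => x /= e; last by rewrite /enorm -/(q x) e sqrtr1.
have q0 : 0 <= q x by apply: sumr_ge0 => *; exact: sqr_ge0.
by rewrite -(sqr_sqrtr q0) -/(enorm x) e expr1n.
Qed.

End box.

(** * Derivatives along lines and the algebra of smooth functions *)

Section lines.
Context {R : realType} {V : normedModType R}.
Implicit Types (F : V -> R) (x v : V).

(** Reduces directional derivatives to one real variable, where the chain rule and
    the mean value theorem are available. *)
Lemma derive_line F x v : 'D_v F x = (fun t : R => F (t *: v + x))^`()%classic 0.
Proof.
rewrite derive1E /derive; set g1 := fun t => t^-1 *: _.
set g2 := fun t => t^-1 *: _; suff -> : g1 = g2 by [].
by apply/funext => t; rewrite /g1 /g2 /= addr0 scale0r add0r [t%:A]mulr1.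
Qed.

Lemma is_derive_line F x v (d : R) :
  is_derive x v F d <-> is_derive (0 : R) 1 (fun t : R => F (t *: v + x)) d.
Proof.
split=> -[df e].
  by split; [exact: (derivable1P F x v).1 | rewrite -derive1E -derive_line].
by split; [exact: (derivable1P F x v).2 | rewrite derive_line derive1E].
Qed.

End lines.

Section mean_value.
Context {R : realType}.

(** Writing the intermediate point as [s * c] treats both signs of [c] at once. *)
Lemma mean_value_scaled (f df : R -> R) (c : R) :
  (forall s, 0 <= s <= 1 -> is_derive (s * c) 1 f (df (s * c))) ->
  exists2 s : R, 0 <= s <= 1 & f c - f 0 = c * df (s * c).
Proof.
move=> dF; have dphi (s : R) : 0 <= s <= 1 ->
    is_derive s 1 (fun s => f (s * c)) (df (s * c) * c).
  move=> s01; have hl : is_derive s 1 (fun s : R => s * c) c.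
    by apply: is_derive_eq; rewrite scaler0 add0r [LHS]mulr1.
  exact: (@is_derive1_comp _ f (fun s : R => s * c) s _ _ (dF s s01) hl).
have cphi : {within `[0, 1], continuous (fun s => f (s * c))}.
  apply: derivable_within_continuous => s; rewrite in_itv /= => s01.
  by have [] := dphi s s01.
have [s s01] := MVT_segment ler01 (fun s hs => dphi s (subset_itv_oo_cc hs)) cphi.
rewrite mul1r mul0r subr0 mulr1 => ->.
by exists s; [move: s01; rewrite in_itv|rewrite mulrC].
Qed.

Lemma line_mean_value (V : normedModType R) (F : V -> R) (x v : V) (c : R) :
  (forall s : R, 0 <= s <= 1 -> derivable F (x + (s * c) *: v) v) ->
  exists2 s : R, 0 <= s <= 1 &
    F (x + c *: v) - F x = c * 'D_v F (x + (s * c) *: v).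
Proof.
move=> dF; pose f (t : R) := F (x + t *: v).
have [s s01 e] : exists2 s : R, 0 <= s <= 1 &
    f c - f 0 = c * 'D_v F (x + (s * c) *: v).
  apply: (@mean_value_scaled f (fun t => 'D_v F (x + t *: v))) => s s01.
  have /is_derive_line h :
      is_derive (x + (s * c) *: v) v F ('D_v F (x + (s * c) *: v)).
    by apply: DeriveDef => //; exact: dF.
  apply/is_derive_line; move: h; congr (is_derive _ _ _ _).
  by apply/funext => t; rewrite /f [_%:A]mulr1 scalerDl addrCA.
by exists s => //; move: e; rewrite /f scale0r addr0.
Qed.

End mean_value.

Section coords.
Context {R : realType} {N : nat}.
Implicit Types (x v : 'rV[R]_N) (i j : 'I_N).

Lemma is_derive_coord x v i :
  is_derive x v (fun x : 'rV[R]_N => x 0 i) (v 0 i).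
Proof.
apply/is_derive_line.
rewrite (_ : (fun t : R => (t *: v + x) 0 i) = (fun t : R => t * v 0 i + x 0 i)).
  apply: is_derive_eq; rewrite /GRing.scale /=; ring.
by apply/funext => t; rewrite !mxE.
Qed.

Lemma is_derive_sqsum x i :
  is_derive x (basis_vec i) (fun x : 'rV[R]_N => \sum_j x 0 j ^+ 2) (2 * x 0 i).
Proof.
have h j : is_derive x (basis_vec i) (fun x : 'rV[R]_N => x 0 j ^+ 2)
    (2 * x 0 j * (i == j)%:R).
  have := is_derive_coord x (basis_vec i) j; rewrite mxE eqxx /= => hj.
  under eq_fun do rewrite expr2.
  apply: is_derive_eq; rewrite /GRing.scale /= eq_sym; ring.
have -> : (fun x : 'rV[R]_N => \sum_j x 0 j ^+ 2) =
  \sum_j (fun x : 'rV[R]_N => x 0 j ^+ 2).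
  by apply/funext => y; rewrite fct_sumE.
apply: is_derive_eq; rewrite (bigD1 i) //= eqxx mulr1 big1 ?addr0 // => j ji.
by rewrite eq_sym (negbTE ji) mulr0.
Qed.

Lemma is_derive_enormV x i : x != 0 ->
  is_derive x (basis_vec i) (fun x : 'rV[R]_N => (enorm x)^-1)
    (- x 0 i * (enorm x)^-1 ^+ 3).
Proof.
move=> x0; have [d e] := is_derive_sqsum x i.
have := is_derive_comp d (is_derive_sqrtV (sqsum_gt0 x0)); rewrite e -/(enorm x).
move=> [d1 e1]; apply: DeriveDef => //; apply: (etrans e1).
by move: (enorm x)^-1 (x 0 i) => a b; field.
Qed.
End coords.

Section algebra.
Context {R : realType} {n : nat}.
Local Notation C := (Csmooth R n).
Implicit Types (u v w : C) (p : sphere R n) (i j : 'I_n.+1).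

Lemma csmooth_ext u v : (forall p, u p = v p) -> u = v.
Proof. by move=> uv; apply: val_inj; apply/funext. Qed.

(** Identities between smooth functions are proved pointwise, the values [ev u p] being
    the atoms of a ring identity. *)
Definition ev u p : R := u p.

Lemma ev_ext u v : (forall p, ev u p = ev v p) -> u = v.
Proof. exact: csmooth_ext. Qed.

Lemma evD u v p : ev (u + v) p = ev u p + ev v p. Proof. by []. Qed.
Lemma evN u p : ev (- u) p = - ev u p. Proof. by []. Qed.
Lemma evZ (c : R) u p : ev (c *: u) p = c * ev u p. Proof. by []. Qed.
Lemma ev0 p : ev 0 p = 0. Proof. by []. Qed.
Lemma evM u v p : ev (csmooth_mul u v) p = ev u p * ev v p. Proof. by []. Qed.
Lemma ev_cst (c : R) p : ev (csmooth_cst c) p = c. Proof. by []. Qed.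
Lemma ev_exp u p : ev (csmooth_exp u) p = expR (ev u p). Proof. by []. Qed.
Lemma ev_sum (I : Type) (r : seq I) (P : pred I) (F : I -> C) p :
  ev (\sum_(i <- r | P i) F i) p = \sum_(i <- r | P i) ev (F i) p.
Proof. by elim/big_rec2: _ => // i y x _ <-. Qed.
Definition evE := (evD, evN, evZ, ev0, evM, ev_cst, ev_exp, ev_sum).

Lemma sphere_neq0 p : val p != 0.
Proof.
apply: contraTneq (valP p) => /= ->.
by rewrite /enorm big1 ?sqrtr0 1?eq_sym ?oner_eq0 // => i _; rewrite mxE expr0n.
Qed.

Lemma radial_proj_val p : radial_proj (val p) = p.
Proof.
apply: val_inj; rewrite radial_projE ?sphere_neq0 //.
by rewrite (eqP (valP p)) invr1 scale1r.
Qed.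

Lemma derivable_rext u x i : x != 0 -> derivable (rext u) x (basis_vec i).
Proof. by move=> x0; have [_] := csmooth_smooth u [::] x0. Qed.

Lemma continuous_rext u (x : 'rV[R]_n.+1) : x != 0 -> {for x, continuous (rext u)}.
Proof. by move=> x0; have [] := csmooth_smooth u [::] x0. Qed.

Lemma tderivD i u v : tderiv i (u + v) = tderiv i u + tderiv i v.
Proof.
apply: csmooth_ext => p; rewrite -[RHS]/(tpartial i u p + tpartial i v p).
by rewrite -(deriveD (@derivable_rext u _ i (sphere_neq0 p))
  (@derivable_rext v _ i (sphere_neq0 p))).
Qed.

Lemma tderivM i u v :
  tderiv i (csmooth_mul u v) = csmooth_mul u (tderiv i v) + csmooth_mul v (tderiv i u).
Proof.
apply: csmooth_ext => p; rewrite [LHS]/=.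
have e : rext u (val p) = u p /\ rext v (val p) = v p.
  by rewrite /rext /= radial_proj_val.
rewrite -[RHS]/(u p * tpartial i v p + v p * tpartial i u p) -e.1 -e.2.
by rewrite -(deriveM (@derivable_rext u _ i (sphere_neq0 p))
  (@derivable_rext v _ i (sphere_neq0 p))).
Qed.

Lemma tderiv_cst i (c : R) : tderiv i (csmooth_cst c) = 0 :> C.
Proof. by apply: csmooth_ext => p; exact: derive_cst. Qed.

Lemma csmooth_cst0 : csmooth_cst 0 = 0 :> C.
Proof. exact: csmooth_ext. Qed.

Lemma csmooth_mulZ (c : R) u : csmooth_mul (csmooth_cst c) u = c *: u.
Proof. exact: csmooth_ext. Qed.

Lemma tderivZ i (c : R) u : tderiv i (c *: u) = c *: tderiv i u.
Proof.
rewrite -csmooth_mulZ tderivM tderiv_cst csmooth_mulZ.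
by apply: ev_ext => p; rewrite !evE mulr0 addr0.
Qed.

Lemma tderiv_exp i u :
  tderiv i (csmooth_exp u) = csmooth_mul (csmooth_exp u) (tderiv i u).
Proof.
apply: csmooth_ext => p; rewrite [LHS]/=.
have d := @derivable_rext u _ i (sphere_neq0 p).
have [_ e] := is_derive_comp d (is_derive_expR _).
by apply: (etrans e); rewrite {1}/rext /= radial_proj_val.
Qed.

HB.instance Definition _ i := GRing.isLinear.Build R C C _ (tderiv i)
  (fun c u v => etrans (tderivD i _ _) (congr1 (+%R^~ _) (tderivZ i c u))).

Definition coordf i : sphere R n -> R := fun p => val p 0 i.

Lemma rext_coordf i x : x != 0 -> rext (coordf i) x = (enorm x)^-1 * x 0 i.
Proof. by move=> x0; rewrite /rext /coordf /= radial_projE // mxE. Qed.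

Lemma smooth_coordf i : smooth_sphere (coordf i).
Proof.
apply/smooth_onP => k; have oO := @punctured_open R n.+1.
apply: (eq_Ck oO _ (CkM oO (Ck_enormV k) (Ck_coord k _ i))) => x x0 /=.
by rewrite rext_coordf.
Qed.

Definition xcoord i : C := of_smooth (smooth_coordf i).

(** The gradient of x_j at p is the tangential projection e_j - p_j p of e_j. *)
Lemma tderiv_coord i j :
  tderiv i (xcoord j) = csmooth_cst (i == j)%:R - csmooth_mul (xcoord i) (xcoord j).
Proof.
apply: csmooth_ext => p.
rewrite -[RHS]/((i == j)%:R - val p 0 i * val p 0 j) [LHS]/=.
have p0 := sphere_neq0 p; set x := val p.
have near0 : \forall y \near x, y != 0.
  by apply: open_nbhs_nbhs; split=> //; exact: punctured_open.
have ne : {near x, rext (coordf j) =1 (fun x => (enorm x)^-1) \* (fun x : 'rV_n.+1 => x 0 j)}.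
  by apply: filterS near0 => y /(rext_coordf j).
rewrite /tpartial (near_eq_derive _ ne).
have [d1 e1] := is_derive_enormV i p0; have [d2 e2] := is_derive_coord x (basis_vec i) j.
rewrite [LHS](deriveM d1 d2) e1 e2 mxE eqxx (eqP (valP p)) /GRing.scale /=.
by rewrite invr1 expr1n eq_sym; ring.
Qed.

Lemma ev_coord i p : ev (xcoord i) p = val p 0 i. Proof. by []. Qed.

End algebra.
(* From here on, smooth functions are atoms handled by the preceding rules only. *)
#[global] Opaque ev tderiv csmooth_mul csmooth_exp csmooth_cst laplacian xcoord.

(** * The Laplacian on polynomials *)

Lemma sumrD (V : nmodType) (I : finType) (F G : I -> V) :
  \sum_i (F i + G i) = \sum_i F i + \sum_i G i.
Proof. exact: big_split. Qed.

Lemma sum_delta (A : pzRingType) (I : finType) (j : I) (F : I -> A) :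
  \sum_i (i == j)%:R * F i = F j.
Proof.
rewrite (bigD1 j) //= eqxx mul1r big1 ?addr0 // => i /negbTE ->.
by rewrite mul0r.
Qed.

Section polynomials.
Context {R : realType} {n : nat}.
Local Notation C := (Csmooth R n).
Local Notation "u ** v" := (csmooth_mul u v) (at level 40, left associativity).
Implicit Types (u v w f g : C) (p : sphere R n) (i j : 'I_n.+1).

Lemma sum_coord2 p : \sum_i ev (xcoord i) p ^+ 2 = 1.
Proof.
have := eqP (valP p); rewrite /enorm => e.
have h : 0 <= \sum_i val p 0 i ^+ 2 :> R by apply: sumr_ge0 => i _; exact: sqr_ge0.
by rewrite -(sqr_sqrtr h) e expr1n.
Qed.

Lemma laplacianE u : laplacian u = - \sum_i tderiv i (tderiv i u).
Proof. by []. Qed.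

Lemma laplacianD u v : laplacian (u + v) = laplacian u + laplacian v.
Proof.
by rewrite !laplacianE -opprD -big_split /=; congr (- _); apply: eq_bigr => i _;
  rewrite !linearD.
Qed.

Lemma laplacianZ (c : R) u : laplacian (c *: u) = c *: laplacian u.
Proof.
by rewrite !laplacianE scalerN scaler_sumr; congr (- _); apply: eq_bigr => i _;
  rewrite !linearZ.
Qed.

HB.instance Definition _ := GRing.isLinear.Build R C C _ (@laplacian R n)
  (fun c u v => etrans (laplacianD _ _) (congr1 (+%R^~ _) (laplacianZ c u))).

Lemma laplacian_cst (c : R) : laplacian (csmooth_cst c : C) = 0.
Proof.
by rewrite laplacianE big1 ?oppr0 // => i _; rewrite tderiv_cst linear0.
Qed.

Lemma laplacianM u v : laplacian (u ** v) =
  u ** laplacian v + v ** laplacian u - 2 *: \sum_i tderiv i u ** tderiv i v.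
Proof.
apply: ev_ext => p; rewrite !laplacianE !evE.
rewrite !mulrN !mulr_sumr -!opprD -!sumrD; congr (- _).
apply: eq_bigr => i _; rewrite tderivM tderivD !tderivM !evE.
move: (ev u p) (ev v p) (ev (tderiv i u) p) (ev (tderiv i v) p) => a b a1 b1.
move: (ev (tderiv i (tderiv i u)) p) (ev (tderiv i (tderiv i v)) p) => a2 b2.
ring.
Qed.

(** As the gradient of x_j is e_j - x_j p, this is the derivative of [u] along e_j
    minus x_j times its derivative along the position vector. *)
Lemma grad_coord u j : \sum_i tderiv i (xcoord j) ** tderiv i u =
  tderiv j u - xcoord j ** \sum_i xcoord i ** tderiv i u.
Proof.
apply: ev_ext => p; rewrite !evE mulr_sumr.
under eq_bigr do rewrite tderiv_coord !evE mulrDl.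
rewrite sumrD sum_delta.
by congr (_ + _); rewrite -sumrN; apply: eq_bigr => i _; rewrite !evE; ring.
Qed.

Lemma euler_coord j : \sum_i xcoord i ** tderiv i (xcoord j) = 0 :> C.
Proof.
apply: ev_ext => p; rewrite !evE.
under eq_bigr do rewrite tderiv_coord !evE mulrDr (mulrC _ (_ == _)%:R).
rewrite sumrD sum_delta.
under eq_bigr do rewrite mulrN mulrA -expr2.
by rewrite sumrN -mulr_suml sum_coord2 mul1r subrr.
Qed.

(** The hypotheses say that the gradients are orthogonal to the position vector,
    hence tangent to the sphere. *)
Lemma eulerM u v : \sum_i xcoord i ** tderiv i u = 0 ->
  \sum_i xcoord i ** tderiv i v = 0 -> \sum_i xcoord i ** tderiv i (u ** v) = 0.
Proof.
move=> hu hv; apply: ev_ext => p.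
have := congr1 (fun f : C => ev f p) hv; have := congr1 (fun f : C => ev f p) hu.
rewrite !evE => eu ew.
transitivity (ev v p * (\sum_i ev (xcoord i ** tderiv i u) p) +
    ev u p * (\sum_i ev (xcoord i ** tderiv i v) p)); last first.
  by rewrite eu ew !mulr0 addr0.
rewrite !mulr_sumr -sumrD; apply: eq_bigr => i _; rewrite tderivM !evE.
move: (ev u p) (ev v p) (ev (tderiv i u) p) (ev (tderiv i v) p) => a b a1 b1.
by ring.
Qed.

Lemma laplacian_coord j : laplacian (xcoord j : C) = n%:R *: xcoord j.
Proof.
apply: ev_ext => p; rewrite laplacianE !evE.
have e i : ev (tderiv i (tderiv i (xcoord j))) p =
   - ev (xcoord j) p + 2 * (ev (xcoord j) p * ev (xcoord i) p ^+ 2) - (i == j)%:R * ev (xcoord i) p.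
  rewrite tderiv_coord linearB /= tderiv_cst tderivM !tderiv_coord !evE eqxx.
  by rewrite mulr1n; ring.
under eq_bigr do rewrite e.
rewrite !sumrD !sumrN sumr_const card_ord sum_delta -!mulr_sumr sum_coord2.
by rewrite -mulr_natl -natr1; ring.
Qed.

(** The restrictions of polynomials of degree less than [k].  This is a filtration
    and not a grading, since the relation sum_j x_j^2 = 1 mixes degrees; the
    decomposition c + sum_j x_j g_j serves induction on the degree. *)
Fixpoint polydeg (k : nat) (f : C) : Prop :=
  if k is k'.+1 then exists (c : R) (g : 'I_n.+1 -> C),
    (forall j, polydeg k' (g j)) /\ f = csmooth_cst c + \sum_j xcoord j ** g j
  else f = 0.

Lemma polydeg0 k : polydeg k 0.
Proof.
elim: k => //= k IH; exists 0, (fun=> 0); split=> //.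
by apply: ev_ext => p; rewrite !evE big1 ?addr0 // => i _; rewrite !evE mulr0.
Qed.

Lemma polydeg_lin k (c : R) f g :
  polydeg k f -> polydeg k g -> polydeg k (c *: f + g).
Proof.
elim: k c f g => [|k IH] c f g /=; first by move=> -> ->; rewrite scaler0 addr0.
move=> [a [f1 [hf1 ->]]] [b [g1 [hg1 ->]]].
exists (c * a + b), (fun j => c *: f1 j + g1 j); split; first by move=> j; exact: IH.
apply: ev_ext => p; rewrite !evE mulrDr addrACA; congr (_ + _).
rewrite mulr_sumr -sumrD; apply: eq_bigr => i _; rewrite !evE.
by move: (ev _ _) (ev _ _) (ev _ _) => x y z; ring.
Qed.

Lemma polydegD k f g : polydeg k f -> polydeg k g -> polydeg k (f + g).
Proof. by move=> hf hg; rewrite -[f]scale1r; exact: polydeg_lin. Qed.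

Lemma polydegZ k (c : R) f : polydeg k f -> polydeg k (c *: f).
Proof. by move=> hf; rewrite -[_ *: _]addr0; apply: polydeg_lin => //; exact: polydeg0. Qed.

Lemma polydegN k f : polydeg k f -> polydeg k (- f).
Proof. by rewrite -scaleN1r; exact: polydegZ. Qed.

Lemma polydeg_sum k (I : Type) (r : seq I) (P : pred I) (F : I -> C) :
  (forall a, P a -> polydeg k (F a)) -> polydeg k (\sum_(i <- r | P i) F i).
Proof.
move=> hF; apply: (@big_ind C (polydeg k)) => //; first exact: polydeg0.
exact: polydegD.
Qed.

Lemma polydeg_cst k (c : R) : polydeg k.+1 (csmooth_cst c).
Proof.
exists c, (fun=> 0); split; first by move=> _; exact: polydeg0.
by apply: ev_ext => p; rewrite !evE big1 ?addr0 // => i _; rewrite !evE mulr0.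
Qed.

Lemma polydeg_coordM k j f : polydeg k f -> polydeg k.+1 (xcoord j ** f).
Proof.
move=> hf; exists 0, (fun i => (i == j)%:R *: f); split; first by move=> i; exact: polydegZ.
apply: ev_ext => p; rewrite !evE add0r -(sum_delta j (fun i => ev (xcoord i) p * ev f p)).
by apply: eq_bigr => i _; rewrite !evE mulrCA.
Qed.

Lemma polydegW k f : polydeg k f -> polydeg k.+1 f.
Proof.
elim: k f => [|k IH] f; first by move=> ->; exact: (polydeg0 1).
move=> [c [g [hg ->]]]; apply: polydegD; first exact: polydeg_cst.
by apply: polydeg_sum => j _; exact/polydeg_coordM/IH/hg.
Qed.

Lemma polydegM k l f g : polydeg k f -> polydeg l g -> polydeg (k + l) (f ** g).
Proof.
move=> + hg; elim: k f => [|k IH] f.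
  move=> ->; rewrite (_ : _ ** _ = 0) ?add0n; first exact: polydeg0.
  by apply: ev_ext => p; rewrite !evE mul0r.
move=> [c [f1 [hf1 ->]]].
have -> : (csmooth_cst c + \sum_j xcoord j ** f1 j) ** g =
    c *: g + \sum_j xcoord j ** (f1 j ** g).
  apply: ev_ext => p; rewrite !evE mulrDl mulr_suml; congr (_ + _).
  by apply: eq_bigr => i _; rewrite !evE mulrA.
apply: polydegD; last first.
  by apply: polydeg_sum => j _; exact/polydeg_coordM/IH/hf1.
apply: polydegZ; elim: {IH hf1} (k.+1) => // i IH; exact: polydegW.
Qed.

Lemma euler_polydeg k f : polydeg k f -> \sum_i xcoord i ** tderiv i f = 0.
Proof.
have e0 (c : R) : \sum_i xcoord i ** tderiv i (csmooth_cst c) = 0 :> C.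
  apply: ev_ext => p; rewrite !evE big1 // => i _.
  by rewrite !evE tderiv_cst ev0 mulr0.
have eD u v : \sum_i xcoord i ** tderiv i u = 0 ->
   \sum_i xcoord i ** tderiv i v = 0 -> \sum_i xcoord i ** tderiv i (u + v) = 0.
  move=> hu hv; transitivity (\sum_i xcoord i ** tderiv i u +
    \sum_i xcoord i ** tderiv i v); last by rewrite hu hv addr0.
  rewrite -sumrD; apply: eq_bigr => i _.
  by apply: ev_ext => p; rewrite tderivD !evE mulrDr.
elim: k f => [|k IH] f.
  by move=> ->; have := e0 0; rewrite csmooth_cst0.
move=> [c [g [hg ->]]]; apply: (eD); first exact: e0.
apply: (@big_ind C (fun v => \sum_i xcoord i ** tderiv i v = 0)) => //.
- by have := e0 0; rewrite csmooth_cst0.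
- by move=> j _; apply: eulerM; [exact: euler_coord|exact/IH/hg].
Qed.

Lemma tderiv_sum i (F : 'I_n.+1 -> C) :
  tderiv i (\sum_j F j) = \sum_j tderiv i (F j).
Proof. exact: raddf_sum. Qed.

(** The tangential derivative of a homogeneous polynomial g of degree l is its
    partial derivative along e_j minus l x_j g.  Adding k x_j g thus cancels the
    term of degree k + 1, which occurs only for l = k. *)
Lemma tderiv_polydeg k g j :
  polydeg k.+1 g -> polydeg k.+1 (tderiv j g + k%:R *: (xcoord j ** g)).
Proof.
elim: k g => [|k IH] g [c [f [hf ->]]].
  rewrite big1 ?addr0; last first.
    by move=> i _; rewrite (hf i); apply: ev_ext => p; rewrite !evE mulr0.
  by rewrite tderiv_cst scale0r addr0; exact: polydeg0.
have -> : tderiv j (csmooth_cst c + \sum_i xcoord i ** f i) +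
    k.+1%:R *: (xcoord j ** (csmooth_cst c + \sum_i xcoord i ** f i)) =
  f j + (k.+1%:R * c) *: (xcoord j ** csmooth_cst 1) +
  \sum_i xcoord i ** (tderiv j (f i) + k%:R *: (xcoord j ** f i)).
  rewrite tderivD tderiv_sum tderiv_cst add0r.
  apply: ev_ext => p; rewrite !evE.
  have -> : \sum_i ev (tderiv j (xcoord i ** f i)) p =
     \sum_i ev (xcoord i) p * ev (tderiv j (f i)) p + ev (f j) p -
     ev (xcoord j) p * \sum_i ev (xcoord i) p * ev (f i) p.
    rewrite mulr_sumr -(sum_delta j (fun i => ev (f i) p)) -sumrN -!sumrD.
    apply: eq_bigr => i _; rewrite tderivM tderiv_coord !evE eq_sym.
    by move: (ev _ _) (ev _ _) (ev _ _) (ev _ _) => x y z t; ring.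
  have -> : \sum_i ev (xcoord i ** (tderiv j (f i) + k%:R *: (xcoord j ** f i))) p =
     \sum_i ev (xcoord i) p * ev (tderiv j (f i)) p +
     k%:R * (ev (xcoord j) p * \sum_i ev (xcoord i) p * ev (f i) p).
    rewrite !mulr_sumr -sumrD; apply: eq_bigr => i _; rewrite !evE.
    by move: (ev _ _) (ev _ _) (ev _ _) (ev _ _) => x y z t; ring.
  have -> : \sum_i ev (xcoord i ** f i) p = \sum_i ev (xcoord i) p * ev (f i) p.
    by apply: eq_bigr => i _; rewrite evE.
  rewrite -(natr1 k); move: (\sum_i _) (\sum_i _) (ev _ _) (ev _ _) => s1 s2 x y.
  by ring.
apply: polydegD; last first.
  by apply: polydeg_sum => i _; exact/polydeg_coordM/IH/hf.
apply: polydegD; first exact/polydegW/hf.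
by apply/polydegZ/polydeg_coordM/polydeg_cst.
Qed.

(** The eigenvalue of the Laplacian on spherical harmonics of degree [k]. *)
Definition mu (k : nat) : R := k%:R * (k%:R + n%:R - 1).

Lemma laplacian_coordM j u : \sum_i xcoord i ** tderiv i u = 0 ->
  laplacian (xcoord j ** u) =
  xcoord j ** laplacian u + n%:R *: (xcoord j ** u) - 2 *: tderiv j u.
Proof.
move=> eu; rewrite laplacianM laplacian_coord grad_coord eu.
apply: ev_ext => p; rewrite !evE.
by move: (ev _ _) (ev _ _) (ev _ _) => x y z; ring.
Qed.

Lemma laplacian_sum (F : 'I_n.+1 -> C) :
  laplacian (\sum_j F j) = \sum_j laplacian (F j).
Proof. exact: raddf_sum. Qed.

(** Induction on the degree: in [laplacian_coordM], tderiv j g is - k x_j g up to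
    smaller degree, and mu (k + 1) = mu k + n + 2 k. *)
Lemma laplacian_polydeg k f :
  polydeg k.+1 f -> polydeg k (laplacian f - mu k *: f).
Proof.
elim: k f => [|k IH] f.
  move=> [c [g [hg ->]]]; rewrite /mu mul0r scale0r subr0.
  rewrite big1 ?addr0 ?laplacian_cst // => i _.
  by rewrite (hg i); apply: ev_ext => p; rewrite !evE mulr0.
move=> [c [g [hg ->]]].
have -> : laplacian (csmooth_cst c + \sum_j xcoord j ** g j) -
   mu k.+1 *: (csmooth_cst c + \sum_j xcoord j ** g j) =
  csmooth_cst (- mu k.+1 * c) +
   \sum_j (xcoord j ** (laplacian (g j) - mu k *: g j) -
     2 *: (tderiv j (g j) + k%:R *: (xcoord j ** g j))).
  rewrite laplacianD laplacian_cst laplacian_sum add0r.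
  under eq_bigr do rewrite (laplacian_coordM _ (@euler_polydeg k.+1 _ (hg _))).
  apply: ev_ext => p; rewrite !(evD, evN, evZ, ev_cst, ev_sum, mulrDr, opprD) addrCA mulNr.
  congr (_ + _).
  rewrite mulr_sumr -sumrN -sumrD; apply: eq_bigr => j _.
  move: (laplacian (g j)) (tderiv j (g j)) => l d; rewrite !evE /mu -(natr1 k).
  by move: (ev _ _) (ev _ _) (ev _ _) (ev _ _) => x y z t; ring.
apply: polydegD; first exact: polydeg_cst.
apply: polydeg_sum => j _; apply: polydegD; first exact/polydeg_coordM/IH/hg.
exact/polydegN/polydegZ/tderiv_polydeg/hg.
Qed.

End polynomials.
Arguments mu {R} n k.

(** * The spectrum of the Paneitz-Branson operator *)

Section spectrum.
Context {R : realType}.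

(** By [mu_factor], the eigenvalue of P_0 in degree k is the value at k + n/2 of this
    polynomial. *)
Definition Aprod (m : nat) (z : R) : R :=
  \prod_(1 <= j < m.+1) ((z - j%:R) * (z + j%:R - 1)).

(** [Aprod m z] is the product of the 2m consecutive factors from z - m to
    z + m - 1; raising z by 1 trades z - m for z + m. *)
Lemma Aprod_shift m z : Aprod m (z + 1) * (z - m%:R) = Aprod m z * (z + m%:R).
Proof.
rewrite /Aprod; elim: m => [|m IH]; first by rewrite !big_geq // subr0 addr0.
rewrite !(big_nat_recr m.+1) //=.
move: IH; set x := \prod_(_ <= _ < _) _; set y := \prod_(_ <= _ < _) _ => IH.
rewrite -(natr1 m).
transitivity (x * (z - m%:R) * ((z + 1 + m%:R) * (z - (m%:R + 1)))); first by ring.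
by rewrite IH; ring.
Qed.

Variables m n : nat.

Definition Lam (k : nat) : R := Aprod m (k%:R + n%:R / 2).

Lemma LamS k : Lam k.+1 * (k%:R + n%:R / 2 - m%:R) = Lam k * (k%:R + n%:R / 2 + m%:R).
Proof. by rewrite -Aprod_shift /Lam -(natr1 k) addrAC. Qed.

Hypothesis mn : admissible m n.

(** The equality would give n even and n = 2 (j - k) < 2 m, against
    admissibility. *)
Lemma half_neq k j : (0 < k)%N -> (j <= m)%N -> k%:R + n%:R / 2 != j%:R :> R.
Proof.
move=> k0 jm; apply/eqP => e.
have : (2 * k%:R + n%:R : R) = 2 * j%:R by rewrite -e; field.
rewrite -!natrM -natrD => /eqP; rewrite eqr_nat => /eqP {}e.
have [_ _ h] := mn; case: (boolP (odd n)) => on.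
  by have := congr1 odd e; rewrite oddD !oddM on.
have := h on; lia.
Qed.

Lemma Lam_neq0 k : (0 < k)%N -> Lam k != 0.
Proof.
move=> k0; rewrite /Lam /Aprod prodf_seq_neq0; apply/allP => j.
rewrite mem_index_iota => /andP[j1 jm]; apply/implyP => _.
rewrite mulf_neq0 // ?subr_eq0 ?half_neq //.
have k1 : (1 : R) <= k%:R by rewrite ler1n.
have n0 : (0 : R) < n%:R by rewrite ltr0n; have [_ + _] := mn; lia.
have j0 : (1 : R) <= j%:R by rewrite ler1n.
by rewrite gt_eqF //; lra.
Qed.

(** Compare absolute values in [LamS], using |k + n/2 - m| < k + n/2 + m. *)
Lemma Lam_lt k : `|Lam k| < `|Lam k.+1|.
Proof.
have [->|L0] := eqVneq (Lam k) 0; first by rewrite normr0 normr_gt0 Lam_neq0.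
have n0 : (0 : R) < n%:R by rewrite ltr0n; have [_ + _] := mn; lia.
have m0 : (0 : R) < m%:R by rewrite ltr0n; have [+ _ _] := mn.
have k0 : (0 : R) <= k%:R by rewrite ler0n.
have := congr1 Num.norm (LamS k); rewrite !normrM => e.
have h : `|k%:R + n%:R / 2 - m%:R| < `|k%:R + n%:R / 2 + m%:R| :> R.
  rewrite [X in _ < X]ger0_norm; last lra.
  by rewrite ltr_norml; apply/andP; split; lra.
rewrite ltNge; apply/negP => le.
have : `|Lam k.+1| * `|k%:R + n%:R / 2 - m%:R| < `|Lam k| * `|k%:R + n%:R / 2 + m%:R|.
  apply: (le_lt_trans (ler_wpM2r _ le)) => //.
  by rewrite ltr_pM2l // normr_gt0.
by rewrite e ltxx.
Qed.

Lemma Lam_norm_mono j k : (j < k)%N -> `|Lam j| < `|Lam k|.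
Proof.
elim: k => // k IH; rewrite ltnS leq_eqVlt => /orP[/eqP->|/IH h]; first exact: Lam_lt.
exact: lt_trans h (Lam_lt k).
Qed.

Lemma Lam_inj j k : j != k -> Lam j != Lam k.
Proof.
rewrite neq_ltn => /orP[]/Lam_norm_mono h; apply: contraTneq h => ->;
  by rewrite ltxx.
Qed.

Lemma LamS0 : Lam 1 * (n%:R / 2 - m%:R) = Lam 0 * (n%:R / 2 + m%:R).
Proof. by have := LamS 0; rewrite !add0r. Qed.

(** Then Lam_1 is the product of the integers from 1 to 2m: for z = 1 + m the 2l
    innermost factors of [Aprod m z] are m - l + 1, ..., m + l. *)
Lemma Lam1_critical : n = m.*2 -> Lam 1 = (m.*2)`!%:R.
Proof.
move=> nm; have key l : (l <= m)%N ->
  Aprod l (1 + m%:R) * (m - l)`!%:R = (m + l)`!%:R.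
  rewrite /Aprod; elim: l => [|l IH] lm.
    by rewrite big_geq // mul1r subn0 addn0.
  rewrite big_nat_recr //= addnS factS natrM -IH ?(ltnW lm) //.
  rewrite subnS; have -> : (m - l = (m - l).-1.+1)%N by lia.
  rewrite factS natrM -[(m - l).-1.+1.-1]/((m - l).-1).
  have -> : ((m - l).-1.+1%:R = m%:R - l%:R :> R).
    by rewrite -natrB ?(ltnW lm) //; congr _%:R; lia.
  by rewrite -(natr1 l) -(natr1 (m + l)) natrD; ring.
have := key m (leqnn m); rewrite subnn fact0 mulr1 addnn => <-.
rewrite /Lam nm -mul2n natrM; congr Aprod.
by field.
Qed.

End spectrum.
Arguments Lam {R} m n k.

Section paneitz.
Context {R : realType} {n : nat}.
Local Notation C := (Csmooth R n).
Local Notation "u ** v" := (csmooth_mul u v) (at level 40, left associativity).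
Implicit Types (f : C).
Variable m : nat.

Lemma paneitz0_ind (K : (C -> C) -> Prop) : K id ->
  (forall A B, K A -> K B -> K (A \o B)) ->
  (forall c : R, K (fun u => laplacian u + c *: u)) -> K (paneitz0 m).
Proof. by move=> h1 h2 h3; apply: (big_ind K). Qed.

Lemma paneitz0D u v : paneitz0 m (u + v) = paneitz0 m u + paneitz0 m v :> C.
Proof.
move: u v; apply: (@paneitz0_ind (fun A => forall u v, A (u + v) = A u + A v)) => //.
  by move=> A B hA hB u v /=; rewrite hB hA.
by move=> c u v; rewrite laplacianD scalerDr addrACA.
Qed.

Lemma paneitz0Z (c : R) u : paneitz0 m (c *: u) = c *: paneitz0 m u :> C.
Proof.
move: u; apply: (@paneitz0_ind (fun A => forall u, A (c *: u) = c *: A u)) => //.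
  by move=> A B hA hB u /=; rewrite hB hA.
by move=> d u; rewrite laplacianZ scalerDr !scalerA mulrC.
Qed.

Lemma mu_factor k j : mu n k + (n%:R / 2 - j%:R) * (n%:R / 2 + j%:R - 1) =
  (k%:R + n%:R / 2 - j%:R) * (k%:R + n%:R / 2 + j%:R - 1) :> R.
Proof. by rewrite /mu; field. Qed.

Lemma paneitz0_eigen k f : laplacian f = mu n k *: f -> paneitz0 m f = Lam m n k *: f.
Proof.
move=> lf; suff : forall c : R, paneitz0 m (c *: f) = (Lam m n k * c) *: f.
  by move=> /(_ 1); rewrite scale1r mulr1.
apply: (big_ind2 (fun (A : C -> C) (a : R) => forall c : R, A (c *: f) = (a * c) *: f)).
- by move=> c; rewrite mul1r.
- by move=> A a B b hA hB c /=; rewrite hB hA mulrA.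
- move=> j _ c; rewrite laplacianZ lf !scalerA -scalerDl -mu_factor.
  by congr (_ *: _); ring.
Qed.

(** Each factor of P_0 is triangular for the degree filtration, with the diagonal
    coefficients of [laplacian_polydeg]. *)
Lemma paneitz0_polydeg k f :
  polydeg k.+1 f -> polydeg k (paneitz0 m f - Lam m n k *: f).
Proof.
move: f; apply: (big_ind2 (fun (A : C -> C) (a : R) =>
  forall f, polydeg k.+1 f -> polydeg k (A f - a *: f))).
- by move=> f hf; rewrite scale1r subrr; exact: polydeg0.
- move=> A a B b hA hB f hf /=.
  have hBf : polydeg k.+1 (B f).
    rewrite -[B f](subrK (b *: f)); apply: polydegD; last exact: polydegZ.
    exact/polydegW/hB.
  rewrite (_ : _ - _ = (A (B f) - a *: B f) + a *: (B f - b *: f)).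
    by apply: polydegD; [exact: hA|exact/polydegZ/hB].
  by rewrite scalerBr addrA subrK scalerA.
- move=> j _ f hf; rewrite -mu_factor scalerDl opprD addrACA subrr addr0.
  exact: laplacian_polydeg.
Qed.

End paneitz.

(** * Functionals subject to the first and second order relations *)

Section vanishing.
Context {R : realType} {n : nat}.
Local Notation C := (Csmooth R n).
Local Notation "u ** v" := (csmooth_mul u v) (at level 40, left associativity).
Implicit Types (f g u v h : C) (i j : 'I_n.+1).

Lemma mu1 : mu n 1 = n%:R :> R.
Proof. by rewrite /mu; ring. Qed.

Lemma laplacian_coord2 i j : i != j ->
  laplacian (xcoord i ** xcoord j) = mu n 2 *: (xcoord i ** xcoord j) :> C.
Proof.
move=> ij; rewrite (laplacian_coordM i (euler_coord j)) laplacian_coord tderiv_coord.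
rewrite (negbTE ij) mulr0n; apply: ev_ext => p; rewrite !evE /mu.
by move: (ev _ _) (ev _ _) => x y; ring.
Qed.

Lemma laplacian_coord3 i j : i != j ->
  laplacian (xcoord j ** (xcoord i ** xcoord j)) =
  mu n 3 *: (xcoord j ** (xcoord i ** xcoord j)) - 2 *: xcoord i :> C.
Proof.
move=> ij; rewrite laplacian_coordM; last first.
  by apply: eulerM; exact: euler_coord.
rewrite laplacian_coord2 // tderivM !tderiv_coord eqxx eq_sym (negbTE ij) mulr1n mulr0n.
apply: ev_ext => p; rewrite !evE /mu.
by move: (ev _ _) (ev _ _) => x y; ring.
Qed.

(** [q] is the restriction of the harmonic polynomial
    x_i x_j^2 - |x|^2 x_i / (n + 3). *)
Lemma laplacian_cubic i j : i != j ->
  let q := xcoord j ** (xcoord i ** xcoord j) - (n%:R + 3)^-1 *: xcoord i : C in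
  laplacian q = mu n 3 *: q.
Proof.
move=> ij /=; rewrite laplacianD -scaleNr laplacianZ laplacian_coord3 // laplacian_coord.
apply: ev_ext => p; rewrite !evE /mu.
have n3 : (n%:R + 3 : R) != 0 by rewrite -natrD pnatr_eq0 addn3.
by move: (ev _ _) (ev _ _) => x y; field.
Qed.

Lemma polydeg1 g : polydeg 1 g -> exists c : R, g = csmooth_cst c.
Proof.
move=> [c [f [hf ->]]]; exists c; rewrite big1 ?addr0 // => i _.
by rewrite (hf i); apply: ev_ext => p; rewrite !evE mulr0.
Qed.

Variables (m : nat) (a b beta kappa : R) (l : C -> R).
Hypothesis lD : forall f g, l (f + g) = l f + l g.
Hypothesis lZ : forall (c : R) f, l (c *: f) = c * l f.

Let l0 : l 0 = 0.
Proof. by rewrite -(scale0r (0 : C)) lZ mul0r. Qed.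

Let lB f g : l (f - g) = l f - l g.
Proof. by rewrite -scaleN1r lD lZ mulN1r. Qed.

Hypothesis mn : admissible m n.
Hypotheses (a0 : a != 0) (beta0 : beta != 0).
Hypothesis hk : a * kappa = beta * Lam m n 1.
Hypothesis hb : b * Lam m n 1 = a * Lam m n 0.
(* [l1]: [l] vanishes on the image of the linearization L of Q at 0.  [l2]: if
   L v = 0, then [l] vanishes on D^2 Q(0)(v, h). *)
Hypothesis l1 : forall h, l (beta *: paneitz0 m h - (a * kappa) *: h) = 0.
Hypothesis l2 : forall v h, beta *: paneitz0 m v = (a * kappa) *: v ->
  l ((beta * b) *: paneitz0 m (v ** h) - (a * beta) *: (h ** paneitz0 m v) -
     a *: (v ** (beta *: paneitz0 m h - (a * kappa) *: h))) = 0.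

(** On degree [k], L is the nonzero factor beta (Lam_k - Lam_1) up to smaller
    degree. *)
Lemma l_top k f : k != 1%N -> (forall g, polydeg k g -> l g = 0) ->
  polydeg k.+1 f -> l f = 0.
Proof.
move=> k1 lk hf; have := l1 f.
have e : paneitz0 m f = (paneitz0 m f - Lam m n k *: f) + Lam m n k *: f by rewrite subrK.
have : l (paneitz0 m f) = Lam m n k * l f.
  by rewrite e lD (lk _ (paneitz0_polydeg m hf)) add0r lZ.
rewrite lB !lZ hk => -> /eqP.
rewrite -mulrA -mulrBr mulf_eq0 (negbTE beta0) /= -mulrBl mulf_eq0.
by rewrite subr_eq0 (negbTE (Lam_inj mn k1)) /= => /eqP.
Qed.

Lemma l_cst g : polydeg 1 g -> l g = 0.
Proof. by apply: l_top => // f ->; exact: l0. Qed.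

(** In degree 1 the linearization carries no information, and [l2] is used with
    v = x_j, h = x_i x_j.  The harmonic of degree 3 in v h is killed by [l], so only
    the component x_i / (n + 3) contributes. *)
Lemma l_coord i : l (xcoord i) = 0.
Proof.
have [j ij] : exists j, i != j.
  have n1 : (1 < n.+1)%N by have [_ + _] := mn; lia.
  have [->|i0] := eqVneq i ord0; last by exists ord0.
  by exists (Ordinal n1).
set v : C := xcoord j; set h : C := xcoord i ** xcoord j.
have Pv : paneitz0 m v = Lam m n 1 *: v.
  by apply: paneitz0_eigen; rewrite mu1 laplacian_coord.
have Ph : paneitz0 m h = Lam m n 2 *: h.
  by apply: paneitz0_eigen; exact: laplacian_coord2.
have e0 : l (v ** h - (n%:R + 3)^-1 *: xcoord i) = 0.
  set q := (X in l X); have Pq : paneitz0 m q = Lam m n 3 *: q.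
    by apply: paneitz0_eigen; exact: laplacian_cubic.
  have /eqP := l1 q; rewrite Pq hk scalerA -scalerBl -mulrBr lZ.
  by rewrite !mulf_eq0 (negbTE beta0) subr_eq0 (negbTE (Lam_inj mn _)) // => /eqP.
have e1 : l (v ** h) = (n%:R + 3)^-1 * l (xcoord i).
  by move/eqP: e0; rewrite lB lZ subr_eq0 => /eqP.
have e2 : paneitz0 m (v ** h) =
   Lam m n 3 *: (v ** h) + ((n%:R + 3)^-1 * (Lam m n 1 - Lam m n 3)) *: xcoord i.
  rewrite -[in LHS](subrK ((n%:R + 3)^-1 *: xcoord i) (v ** h)) paneitz0D paneitz0Z.
  rewrite (paneitz0_eigen m (laplacian_cubic ij)) -/v.
  rewrite (@paneitz0_eigen _ _ m 1 (xcoord i)) ?mu1 ?laplacian_coord //.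
  by apply: ev_ext => p; rewrite !evE; move: (ev _ _) (ev _ _) (_^-1) => x y z; ring.
have Lv : beta *: paneitz0 m v = (a * kappa) *: v by rewrite Pv hk scalerA.
have := l2 h Lv; rewrite Pv Ph hk e2.
have -> : (beta * b) *: (Lam m n 3 *: (v ** h) +
     ((n%:R + 3)^-1 * (Lam m n 1 - Lam m n 3)) *: xcoord i) -
   (a * beta) *: (h ** (Lam m n 1 *: v)) -
   a *: (v ** (beta *: (Lam m n 2 *: h) - (beta * Lam m n 1) *: h)) =
   (beta * (b * Lam m n 3 - a * Lam m n 2)) *: (v ** h) +
   (beta * b * ((n%:R + 3)^-1 * (Lam m n 1 - Lam m n 3))) *: xcoord i.
  by apply: ev_ext => p; rewrite /h /v !evE; move: (ev _ _) (ev _ _) (_^-1) => x y z; ring.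
rewrite lD !lZ e1.
set t := (_)^-1; set li := l _ => e.
have {}e : beta * (a * (t * (li * (Lam m n 0 - Lam m n 2)))) = 0.
  have e' : beta * (t * (li * (b * Lam m n 1 - a * Lam m n 2))) = 0 by rewrite -[RHS]e; ring.
  by rewrite -[RHS]e' hb; ring.
have t0 : t != 0 by rewrite invr_eq0 -natrD pnatr_eq0 addn3.
move/eqP: e; rewrite !mulf_eq0 (negbTE beta0) (negbTE a0) (negbTE t0) subr_eq0.
by rewrite (negbTE (Lam_inj mn _)) //= orbF => /eqP.
Qed.

Lemma l_polydeg k f : polydeg k f -> l f = 0.
Proof.
elim: k f => [|k IH] f; first by move=> ->; exact: l0.
have [->|k1] := eqVneq k 1%N; last exact: l_top.
move=> [c [g [hg ->]]]; rewrite lD (l_cst (polydeg_cst 0 c)) add0r.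
apply: (big_ind (fun u => l u = 0)) => // [u v lu lv|j _]; first by rewrite lD lu lv addr0.
have [d ->] := polydeg1 (hg j).
rewrite (_ : _ ** _ = d *: xcoord j); last by apply: ev_ext => p; rewrite !evE mulrC.
by rewrite lZ l_coord mulr0.
Qed.

End vanishing.

(** * Uniform convergence of jets *)

Lemma cvg_initial (S : choiceType) (T : topologicalType) (f : S -> T)
    (F : set_system S) (s : S) : Filter F ->
  f x @[x --> F] --> f s -> F --> (s : initial_topology f).
Proof.
move=> FF h A [_ [[B Bop <-] Bfs sBfA]].
have /h FB : nbhs (f s) B by exact: open_nbhs_nbhs.
exact: filterS sBfA FB.
Qed.

Lemma cvg_ptws (I : Type) (V : topologicalType) (F : set_system (I -> V))
    (f : I -> V) : Filter F ->
  (forall i, g i @[g --> F] --> f i) -> F --> (f : {ptws I -> V}).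
Proof. by move=> FF h; apply/cvg_sup => i; apply: cvg_initial; exact: h. Qed.

Section uniform_convergence.
Context {R : realType} {X : Type} {T : Type} (A : set X) (F : set_system T).
Context {FF : Filter F}.
Implicit Types (g h : T -> X -> R) (l m : X -> R).

Definition ucvg g l :=
  forall e, 0 < e -> \forall t \near F, forall x, A x -> `|g t x - l x| < e.

Lemma ucvg_near g h l : (\forall t \near F, forall x, A x -> g t x = h t x) ->
  ucvg g l -> ucvg h l.
Proof.
move=> gh gl e e0; apply: filterS2 gh (gl e e0) => t gh hl x Ax.
by rewrite -gh //; exact: hl.
Qed.

Lemma ucvg_eqr g l m : (forall x, A x -> l x = m x) -> ucvg g l -> ucvg g m.
Proof.
move=> lm gl e e0; apply: filterS (gl e e0) => t h x Ax.
by rewrite -lm //; exact: h.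
Qed.

Lemma ucvg_cst l : ucvg (fun=> l) l.
Proof. by move=> e e0; apply: filterE => t x _; rewrite subrr normr0. Qed.

Lemma ucvgD g h l m : ucvg g l -> ucvg h m ->
  ucvg (fun t x => g t x + h t x) (fun x => l x + m x).
Proof.
move=> gl hm e e0; have e2 : 0 < e / 2 by rewrite divr_gt0.
apply: filterS2 (gl _ e2) (hm _ e2) => t gt ht x Ax.
rewrite opprD addrACA (splitr e); apply: le_lt_trans (ler_normD _ _) _.
by apply: ltrD; [exact: gt|exact: ht].
Qed.

(** Without the bounds on the limits, the products need not converge uniformly. *)
Lemma ucvgM g h l m (M : R) :
  (forall x, A x -> `|l x| <= M) -> (forall x, A x -> `|m x| <= M) ->
  ucvg g l -> ucvg h m ->
  ucvg (fun t x => g t x * h t x) (fun x => l x * m x).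
Proof.
move=> lM mM gl hm e e0.
pose K := `|M| + 1; have K1 : 1 <= K by rewrite lerDr.
have K0 : 0 < K by exact: lt_le_trans K1.
pose d := Num.min 1 (e / (3 * K)).
have d0 : 0 < d by rewrite lt_min ltr01 divr_gt0 // mulr_gt0.
apply: filterS2 (gl _ d0) (hm _ d0) => t gt ht x Ax.
have {}lM : `|l x| <= K.
  by apply: le_trans (lM x Ax) _; rewrite (le_trans (ler_norm M)) // lerDl.
have {}mM : `|m x| <= K.
  by apply: le_trans (mM x Ax) _; rewrite (le_trans (ler_norm M)) // lerDl.
have {gt} := gt x Ax; have {ht} := ht x Ax.
set a := g t x - _; set b := h t x - _ => hb ha.
have -> : g t x * h t x - l x * m x = a * m x + l x * b + a * b.
  by rewrite /a /b; ring.
have [d1 de] : d <= 1 /\ d * (3 * K) <= e.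
  by split; [rewrite ge_min lexx|rewrite -ler_pdivlMr ?mulr_gt0 // ge_min lexx orbT].
apply: le_lt_trans (ler_normD _ _) _.
apply: le_lt_trans (lerD (ler_normD _ _) (lexx _)) _; rewrite !normrM.
have h1 : `|a| * `|m x| <= d * K by apply: ler_pM => //; exact: ltW.
have h2 : `|l x| * `|b| <= d * K by rewrite mulrC; apply: ler_pM => //; exact: ltW.
have h3 : `|a| * `|b| < d * K.
  apply: le_lt_trans (_ : _ <= `|a| * 1) _.
    by apply: ler_wpM2l => //; apply: ltW; exact: lt_le_trans d1.
  rewrite mulr1; apply: lt_le_trans ha _; exact: ler_peMr (ltW d0) K1.
by lra.
Qed.

End uniform_convergence.

Section expR_bounds.
Context {R : realType}.
Implicit Types x : R.

Lemma expRB1_bounds x : x <= expR x - 1 <= x * expR x.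
Proof.
apply/andP; split; first by rewrite lerBrDl expR_ge1Dx.
have := expR_ge1Dx (- x); have := expR_gt0 x; have := expRxMexpNx_1 x.
move: (expR x) (expR (- x)) => a b ab a0 hb.
by have := ler_wpM2l (ltW a0) hb; rewrite ab; lra.
Qed.

Lemma norm_expRB1 x : `|expR x - 1| <= `|x| * expR `|x|.
Proof.
have /andP[h1 h2] := expRB1_bounds x; have [x0|x0] := leP 0 x.
  by rewrite (ger0_norm x0) ger0_norm // (le_trans x0).
rewrite (ltr0_norm x0).
have ex : expR x <= 1 by rewrite expR_le1 ltW.
rewrite ler0_norm ?subr_le0 // opprB.
have : 1 <= expR (- x) by rewrite (le_trans _ (expR_ge1Dx _)) // lerDl oppr_ge0 ltW.
by move: (expR (- x)) => b b1; nra.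
Qed.

Lemma norm_expRB1x x : `|expR x - 1 - x| <= x ^+ 2 * expR `|x|.
Proof.
have /andP[h1 h2] := expRB1_bounds x.
rewrite ger0_norm ?subr_ge0 //; apply: (@le_trans _ _ (x * (expR x - 1))); first lra.
apply: le_trans (ler_norm _) _; rewrite normrM.
apply: le_trans (ler_wpM2l (normr_ge0 _) (norm_expRB1 x)) _.
by rewrite mulrA -normrM -expr2 ger0_norm ?sqr_ge0.
Qed.

End expR_bounds.

Section jets.
Context {R : realType} {n : nat}.
Local Notation C := (Csmooth R n).
Local Notation "u ** v" := (csmooth_mul u v) (at level 40, left associativity).
Implicit Types (u v f : C).

(** By compactness of the sphere. *)
Lemma ev_bounded u : exists M, forall p, `|ev u p| <= M.
Proof.
have cS : compact (val @` [set: sphere R n]).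
  rewrite (_ : _ @` _ = [set x | enorm x = 1]); first exact: compact_enorm1.
  apply/seteqP; split => [x [p _ <-]|x /= e]; first by apply/eqP; exact: (valP p).
  by exists (exist _ x (introT eqP e)).
have : compact ((rext u) @` (val @` [set: sphere R n])).
  apply: continuous_compact cS; apply: continuous_in_subspaceT => x.
  rewrite inE => -[p _ <-]; exact: continuous_rext (sphere_neq0 p).
move=> /compact_bounded [M [_ hM]]; exists (M + 1) => p; apply: hM; first by rewrite ltrDl.
by exists (val p); [exists p|rewrite /rext /= radial_proj_val].
Qed.

Context {T : Type} (F : set_system T) {FF : Filter F}.
Implicit Types (g h : T -> C).

(** The recursion on the order of the derivatives follows the product and chain
    rules for [tderiv], which give stability of this notion by induction on [k]. *)
Fixpoint jcvg k g u : Prop :=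
  ucvg setT F (fun t => ev (g t)) (ev u) /\
  if k is k'.+1 then forall i, jcvg k' (fun t => tderiv i (g t)) (tderiv i u)
  else True.

Lemma jcvg_C0 k g u : jcvg k g u -> ucvg setT F (fun t => ev (g t)) (ev u).
Proof. by case: k => [|k] []. Qed.

Lemma jcvgW k g u : jcvg k.+1 g u -> jcvg k g u.
Proof.
elim: k g u => [|k IH] g u [h1 h2]; first by split.
by split=> // i; apply: IH; exact: h2.
Qed.

Lemma jcvg_near k g h u : (\forall t \near F, g t = h t) ->
  jcvg k g u -> jcvg k h u.
Proof.
move=> gh; elim: k g h u gh => [|k IH] g h u gh [h1 h2]; split => //;
  try by apply: ucvg_near h1; apply: filterS gh => t ->.
by move=> i; apply: IH (h2 i); apply: filterS gh => t ->.
Qed.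

Lemma jcvg_cst k u : jcvg k (fun=> u) u.
Proof. by elim: k u => [|k IH] u; split => //; exact: ucvg_cst. Qed.

Lemma jcvgD k g h u v : jcvg k g u -> jcvg k h v ->
  jcvg k (fun t => g t + h t) (u + v).
Proof.
elim: k g h u v => [|k IH] g h u v [g1 g2] [h1 h2]; split => //; try exact: ucvgD.
move=> i; rewrite tderivD; under eq_fun do rewrite tderivD.
by apply: IH; [exact: g2|exact: h2].
Qed.

Lemma jcvgM k g h u v : jcvg k g u -> jcvg k h v ->
  jcvg k (fun t => g t ** h t) (u ** v).
Proof.
have base g' h' u' v' : ucvg setT F (fun t => ev (g' t)) (ev u') ->
  ucvg setT F (fun t => ev (h' t)) (ev v') ->
  ucvg setT F (fun t => ev (g' t ** h' t)) (ev (u' ** v')).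
  move=> hg hh; have [M1 hM1] := ev_bounded u'; have [M2 hM2] := ev_bounded v'.
  apply: (ucvgM (M := Num.max M1 M2)) => // p _; rewrite le_max.
    by rewrite hM1.
  by rewrite hM2 orbT.
elim: k g h u v => [|k IH] g h u v hg hh; split => //;
  try by apply: base; [exact: jcvg_C0 hg|exact: jcvg_C0 hh].
move=> i; rewrite tderivM; under eq_fun do rewrite tderivM.
by apply: jcvgD; apply: IH; [exact: jcvgW hg|have [_] := hh; apply|
  exact: jcvgW hh|have [_] := hg; apply].
Qed.

Lemma jcvgZ k (c : T -> R) (c0 : R) g u : c t @[t --> F] --> c0 ->
  jcvg k g u -> jcvg k (fun t => c t *: g t) (c0 *: u).
Proof.
move=> cc hg; rewrite -csmooth_mulZ; under eq_fun do rewrite -csmooth_mulZ.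
have base : ucvg setT F (fun t => ev (csmooth_cst (c t) : C)) (ev (csmooth_cst c0)).
  move=> e e0; have /cvgrPdist_lt/(_ e e0) := cc; apply: filterS => t h p _.
  by rewrite distrC !ev_cst.
apply: jcvgM hg; case: k => [|k]; split => // i.
rewrite tderiv_cst; under eq_fun do rewrite tderiv_cst.
exact: jcvg_cst.
Qed.

Lemma jcvg_exp k g u : jcvg k g u ->
  jcvg k (fun t => csmooth_exp (g t)) (csmooth_exp u).
Proof.
have base g' u' : ucvg setT F (fun t => ev (g' t)) (ev u') ->
  ucvg setT F (fun t => ev (csmooth_exp (g' t))) (ev (csmooth_exp u')).
  move=> hg e e0; have [M hM] := ev_bounded u'.
  have K0 : 0 < expR (M + 1) by exact: expR_gt0.
  have d0 : 0 < Num.min 1 (e / expR (M + 1)) by rewrite lt_min ltr01 divr_gt0.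
  apply: filterS (hg _ d0) => t h p _; have {h} := h p I.
  rewrite !ev_exp lt_min => /andP[d1 de]; set d := ev (g' t) p - _ in d1 de *.
  have -> : expR (ev (g' t) p) - expR (ev u' p) = expR (ev u' p) * (expR d - 1).
    by rewrite mulrBr -expRD mulr1 /d (addrC (ev u' p)) subrK.
  rewrite normrM ger0_norm ?expR_ge0 //.
  apply: le_lt_trans (ler_wpM2l (expR_ge0 _) (norm_expRB1 d)) _.
  rewrite mulrCA -expRD; apply: le_lt_trans (_ : _ <= `|d| * expR (M + 1)) _.
    apply: ler_wpM2l => //; rewrite ler_expR; apply: lerD; last exact: ltW.
    exact: le_trans (ler_norm _) (hM p).
  by rewrite -ltr_pdivlMr.
elim: k g u => [|k IH] g u [h1 h2]; split => //; try exact: base.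
move=> i; rewrite tderiv_exp; under eq_fun do rewrite tderiv_exp.
by apply: jcvgM; [apply: IH; apply: jcvgW; split|exact: h2].
Qed.

Lemma jcvg_tderiv k g u i : jcvg k.+1 g u ->
  jcvg k (fun t => tderiv i (g t)) (tderiv i u).
Proof. by move=> [_ h]; exact: h. Qed.

Definition scvg g u := forall k, jcvg k g u.

Lemma scvg_near g h u : (\forall t \near F, g t = h t) -> scvg g u -> scvg h u.
Proof. by move=> gh hg k; exact: jcvg_near gh (hg k). Qed.

Lemma scvg_cst u : scvg (fun=> u) u.
Proof. by move=> k; exact: jcvg_cst. Qed.

Lemma scvgD g h u v : scvg g u -> scvg h v -> scvg (fun t => g t + h t) (u + v).
Proof. by move=> hg hh k; exact: jcvgD. Qed.

Lemma scvgM g h u v : scvg g u -> scvg h v -> scvg (fun t => g t ** h t) (u ** v).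
Proof. by move=> hg hh k; exact: jcvgM. Qed.

Lemma scvgZ (c : T -> R) (c0 : R) g u : c t @[t --> F] --> c0 ->
  scvg g u -> scvg (fun t => c t *: g t) (c0 *: u).
Proof. by move=> cc hg k; exact: jcvgZ. Qed.

Lemma scvgZr (c : R) g u : scvg g u -> scvg (fun t => c *: g t) (c *: u).
Proof. by apply: scvgZ; exact: cvg_cst. Qed.

Lemma scvgN g u : scvg g u -> scvg (fun t => - g t) (- u).
Proof. by rewrite -scaleN1r; under eq_fun do rewrite -scaleN1r; exact: scvgZr. Qed.

Lemma scvg_exp g u : scvg g u -> scvg (fun t => csmooth_exp (g t)) (csmooth_exp u).
Proof. by move=> hg k; exact: jcvg_exp. Qed.

Lemma scvg_laplacian g u : scvg g u -> scvg (fun t => laplacian (g t)) (laplacian u).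
Proof.
move=> hg; rewrite laplacianE; under eq_fun do rewrite laplacianE.
apply: scvgN; elim: (index_enum _) => [|i r IH].
  by rewrite big_nil; under eq_fun do rewrite big_nil; exact: scvg_cst.
rewrite big_cons; under eq_fun do rewrite big_cons; apply: scvgD IH => k.
by do 2!apply: jcvg_tderiv; exact: hg.
Qed.

Lemma scvg_paneitz0 m g u : scvg g u ->
  scvg (fun t => paneitz0 m (g t)) (paneitz0 m u).
Proof.
move: g u; apply: (@paneitz0_ind _ _ m (fun A => forall g u, scvg g u ->
  scvg (fun t => A (g t)) (A u))) => //.
  by move=> A B hA hB g u hg; apply: hA; exact: hB.
by move=> c g u hg; apply: scvgD; [exact: scvg_laplacian|exact: scvgZr].
Qed.

(** A jet applies the last letter of its word first, hence an induction from the
    right. *)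
Lemma jcvg_jet s g u : jcvg (size s) g u ->
  ucvg setT F (fun t => jet (g t) s) (jet u s).
Proof.
elim/last_ind: s g u => [|s i IH] g u; first by case.
have e (f : C) : jet f (rcons s i) = jet (tderiv i f) s.
  exact: foldr_rcons.
rewrite size_rcons => -[_ /(_ i)/IH]; rewrite e.
by under eq_fun do rewrite -e.
Qed.

Lemma scvg_cvg g u : scvg g u -> g t @[t --> F] --> u.
Proof.
move=> hg; apply: cvg_initial; apply: cvg_ptws => s.
move=> P /uniform_nbhs [E [entE EP]]; rewrite /= in EP.
have := jcvg_jet (hg (size s)).
move: entE; rewrite -entourage_ballE => -[e /= e0 eE] /(_ e e0).
apply: filterS => t h; apply: EP => p _; apply: eE; rewrite /= /ball /= distrC.
exact: h.
Qed.

End jets.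

(** * Directional derivatives of smooth functionals *)

Section gateaux_theory.
Context {R : realType} {E : preTopologicalLmodType R}.
Implicit Types (f K : E -> R) (u v h : E).

Lemma is_derive_gateaux f u v (t : R) :
  derivable (fun s : R => f (u + t *: v + s *: v)) 0 1 ->
  is_derive t 1 (fun s : R => f (u + s *: v)) (gateaux v f (u + t *: v)).
Proof.
move=> d; apply/is_derive_line; rewrite /gateaux derive1E.
rewrite (_ : (fun s : R => f (u + (s *: (1 : R) + t) *: v)) =
  (fun s : R => f (u + t *: v + s *: v))); first exact: DeriveDef.
by apply/funext => s; rewrite -addrA -scalerDl [s%:A]mulr1 (addrC t).
Qed.

Lemma gateaux_mean_value f u v (c : R) :
  (forall s : R, 0 <= s <= 1 ->
    derivable (fun r : R => f (u + (s * c) *: v + r *: v)) 0 1) ->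
  exists2 s : R, 0 <= s <= 1 &
    f (u + c *: v) - f u = c * gateaux v f (u + (s * c) *: v).
Proof.
move=> d; have [s s01 e] := @mean_value_scaled _ (fun t => f (u + t *: v))
  (fun t => gateaux v f (u + t *: v)) c (fun s s01 => is_derive_gateaux (d s s01)).
by exists s => //; move: e; rewrite scale0r addr0.
Qed.

Context (U : set E) (K : E -> R) (smK : frechet_smooth_on U K).

Lemma smooth_derivable0 u v : U u ->
  derivable (fun t : R => K (u + t *: v)) 0 1.
Proof.
move=> Uu; have [_ /(_ v)] := @smK 0 u (fun _ => 0) Uu.
rewrite (_ : iter_gateaux K _ = K) //.
by rewrite /iter_gateaux enum_ord0.
Qed.

Lemma iter_gateaux1 (h : 'I_1 -> E) : iter_gateaux K h = gateaux (h ord0) K.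
Proof. by rewrite /iter_gateaux enum_ordSl enum_ord0. Qed.

Lemma iter_gateaux2 (h : 'I_2 -> E) :
  iter_gateaux K h = gateaux (h ord0) (gateaux (h ord_max) K).
Proof.
rewrite /iter_gateaux !enum_ordSl enum_ord0 /=.
by rewrite (_ : lift ord0 ord0 = ord_max) //; exact: val_inj.
Qed.

Lemma smooth_derivable1 u v h : U u ->
  derivable (fun t : R => gateaux h K (u + t *: v)) 0 1.
Proof.
move=> Uu; have [_ /(_ v)] := @smK 1 u (fun _ => h) Uu.
by rewrite iter_gateaux1.
Qed.

Context {T : Type} (F : set_system T) {FF : Filter F}.

Lemma smooth_continuous1 (g h : T -> E) u v : U u ->
  g t @[t --> F] --> u -> h t @[t --> F] --> v ->
  gateaux (h t) K (g t) @[t --> F] --> gateaux v K u.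
Proof.
move=> Uu gu hv; have [c _] := @smK 1 u (fun _ => v) Uu.
have hv' : (fun t => (fun _ => h t) : {ptws 'I_1 -> E}) @ F --> ((fun _ => v) : {ptws 'I_1 -> E}).
  by apply: cvg_ptws => i; exact: hv.
have hp : (fun t => (g t, (fun _ => h t) : {ptws 'I_1 -> E})) @ F -->
    (u, (fun _ => v) : {ptws 'I_1 -> E}) by exact: (cvg_pair gu hv').
have := cvg_comp _ _ hp c; rewrite /comp /= iter_gateaux1.
by under eq_fun do rewrite iter_gateaux1.
Qed.

Lemma smooth_continuous2 (g h1 h2 : T -> E) u v1 v2 : U u ->
  g t @[t --> F] --> u -> h1 t @[t --> F] --> v1 -> h2 t @[t --> F] --> v2 ->
  gateaux (h1 t) (gateaux (h2 t) K) (g t) @[t --> F] --> gateaux v1 (gateaux v2 K) u.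
Proof.
move=> Uu gu h1v h2v.
pose w (a b : E) : {ptws 'I_2 -> E} := fun i => if i == ord0 then a else b.
have [c _] := @smK 2 u (w v1 v2) Uu.
have hw : (fun t => w (h1 t) (h2 t)) @ F --> w v1 v2.
  apply: cvg_ptws => i; change ((fun t => w (h1 t) (h2 t) i) @ F --> w v1 v2 i).
  by rewrite /w; case: (i == ord0); [exact: h1v|exact: h2v].
have hp : (fun t => (g t, w (h1 t) (h2 t))) @ F --> (u, w v1 v2) by exact: (cvg_pair gu hw).
have := cvg_comp _ _ hp c; rewrite /comp /= iter_gateaux2.
by under eq_fun do rewrite iter_gateaux2.
Qed.

End gateaux_theory.

(** * First and second order consequences of a constraint *)

Lemma cvgR_unique (R : realType) (T : Type) (F : set_system T) {PF : ProperFilter F}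
    (f : T -> R) (a b : R) :
  f t @[t --> F] --> a -> f t @[t --> F] --> b -> a = b.
Proof. by move=> fa fb; apply: (@norm_cvg_unique _ _ (f @ F)). Qed.

Section calculus_along_curves.
Context {R : realType} {n : nat}.
Local Notation C := (Csmooth R n).
Implicit Types (u v h : C) (f : C -> R).

Lemma dnbhs_cvg0 : t @[t --> (0 : R)^'] --> (0 : R).
Proof. by apply: cvg_within_filter; exact: cvg_id. Qed.

Lemma near_dnbhs_neq0 : \forall t \near (0 : R)^', t != 0.
Proof. exact: nbhs_dnbhs_neq. Qed.

(** The factors [c t] need not converge. *)
Lemma scvg_bounded (T : Type) (F : set_system T) {FF : Filter F}
    (c : T -> R) (g : T -> C) :
  (forall t, 0 <= c t <= 1) -> scvg F g 0 -> scvg F (fun t => c t *: g t) 0.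
Proof.
move=> c01 hg k.
have base g' : ucvg setT F (fun t => ev (g' t)) (ev (0 : C)) ->
    ucvg setT F (fun t => ev (c t *: g' t)) (ev (0 : C)).
  move=> hg' e e0; apply: filterS (hg' e e0) => t h p _.
  have := h p I; rewrite !evE !subr0 normrM; apply: le_lt_trans.
  by have /andP[c0 c1] := c01 t; rewrite ger0_norm //; apply: ler_piMl.
elim: k g {hg}(hg k) => [|k IH] g [h1 h2]; split => //; try exact: base.
move=> i; rewrite linear0; under eq_fun do rewrite tderivZ.
by apply: IH; have := h2 i; rewrite linear0.
Qed.

Context (U : set C) (oU : open U).

(** No convex neighborhood is needed: if some segment leaves [U], choose [c t] to be a
    parameter at which it does so, and 0 otherwise.  The points g t + c t v t still
    converge to [u], hence they eventually lie in [U]. *)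
Lemma segment_in (T : Type) (F : set_system T) {FF : Filter F} (g v : T -> C) u :
  U u -> scvg F g u -> scvg F v 0 ->
  \forall t \near F, forall s : R, 0 <= s <= 1 -> U (g t + s *: v t).
Proof.
move=> Uu gu v0.
have /choice[c hc] : forall t, exists c : R, 0 <= c <= 1 /\
    (U (g t + c *: v t) -> forall s : R, 0 <= s <= 1 -> U (g t + s *: v t)).
  move=> t; have [[s [s01 nU]]|h] := pselect (exists s : R, 0 <= s <= 1 /\ ~ U (g t + s *: v t)).
    by exists s.
  exists 0; rewrite lexx ler01; split=> // _ s s01.
  by apply: contrapT => nU; apply: h; exists s.
have : scvg F (fun t => g t + c t *: v t) u.
  rewrite -[u]addr0; apply: scvgD => //; apply: scvg_bounded v0 => t.
  by have [] := hc t.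
move=> /scvg_cvg gU; have nU : nbhs u U by apply: open_nbhs_nbhs; split.
have hU : \forall t \near F, U (g t + c t *: v t) := gU _ nU.
apply: filterS hU => t.
by have [_] := hc t; apply.
Qed.

(** The regularity on which the chain rule relies.  Functionals of the form
    [gateaux h K] have it as well as [K], which gives access to second
    derivatives. *)
Definition curve_C1 f := (forall u v, U u -> derivable (fun t : R => f (u + t *: v)) 0 1) /\
  (forall (T : Type) (F : set_system T) (FF : Filter F) (g v : T -> C) u v0,
    U u -> scvg F g u -> scvg F v v0 ->
    gateaux (v t) f (g t) @[t --> F] --> gateaux v0 f u).

(** The chain rule, from the mean value theorem on the segment from g t to
    g t + c t v t. *)
Lemma diff_quotient f (T : Type) (F : set_system T) {FF : Filter F}
    (g v : T -> C) (c : T -> R) u v0 : curve_C1 f -> U u ->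
  scvg F g u -> scvg F v v0 -> c t @[t --> F] --> (0 : R) ->
  (\forall t \near F, c t != 0) ->
  (c t)^-1 * (f (g t + c t *: v t) - f (g t)) @[t --> F] --> gateaux v0 f u.
Proof.
move=> [Df Cf] Uu gu vv c0 cn.
have cv0 : scvg F (fun t => c t *: v t) 0 by rewrite -(scale0r v0); exact: scvgZ.
have /choice[th hth] : forall t, exists s : R, 0 <= s <= 1 /\
    ((forall s : R, 0 <= s <= 1 -> U (g t + s *: (c t *: v t))) ->
     f (g t + c t *: v t) - f (g t) =
     c t * gateaux (v t) f (g t + (s * c t) *: v t)).
  move=> t; have [hU|nU] := pselect (forall s : R, 0 <= s <= 1 -> U (g t + s *: (c t *: v t))); last first.
    by exists 0; rewrite lexx ler01; split.
  have [s s01 e] : exists2 s : R, 0 <= s <= 1 & f (g t + c t *: v t) - f (g t) =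
     c t * gateaux (v t) f (g t + (s * c t) *: v t).
    by apply: gateaux_mean_value => s s01; apply: Df; rewrite -scalerA; exact: hU.
  by exists s.
have : gateaux (v t) f (g t + (th t * c t) *: v t) @[t --> F] --> gateaux v0 f u.
  apply: Cf => //; rewrite -[u]addr0; apply: scvgD => //.
  under eq_fun do rewrite -scalerA.
  by apply: scvg_bounded cv0 => t; have [] := hth t.
apply: cvg_trans; apply: near_eq_cvg.
apply: filterS2 (segment_in Uu gu cv0) cn => t hU cn.
by have [_ /(_ hU) ->] := hth t; rewrite mulKf.
Qed.

Lemma diff_quotient0 f (g v : R -> C) u v0 : curve_C1 f -> U u ->
  scvg (0 : R)^' g u -> scvg (0 : R)^' v v0 ->
  t^-1 * (f (g t + t *: v t) - f (g t)) @[t --> (0 : R)^'] --> gateaux v0 f u.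
Proof.
move=> hf Uu gu vv.
exact: (diff_quotient hf Uu gu vv dnbhs_cvg0 near_dnbhs_neq0).
Qed.

Lemma scvg_near0 (g : R -> C) u (P : C -> Prop) : scvg (0 : R)^' g u ->
  (\forall w \near u, P w) -> \forall t \near (0 : R)^', P (g t).
Proof. by move=> /scvg_cvg gu; exact: gu. Qed.

Let cst0 u : scvg (0 : R)^' (fun=> u) u.
Proof. exact: scvg_cst. Qed.

Lemma gateaux0 f u : gateaux 0 f u = 0.
Proof.
rewrite /gateaux; under eq_fun do rewrite scaler0 addr0.
by rewrite derive1_cst.
Qed.

Lemma gateauxZ f (c : R) u h : curve_C1 f -> U u ->
  gateaux (c *: h) f u = c * gateaux h f u.
Proof.
move=> [Df _] Uu.
have hg : is_derive (0 : R) 1 (fun s : R => f (u + s *: h)) (gateaux h f u).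
  by rewrite /gateaux derive1E; apply: DeriveDef => //; exact: Df.
rewrite {1}/gateaux derive1E.
have hl : is_derive (0 : R) 1 (fun s : R => s * c) c.
  by apply: is_derive_eq; rewrite scaler0 add0r [LHS]mulr1.
rewrite -[X in is_derive X](mul0r c) in hg.
have [_ e] := @is_derive1_comp _ (fun s : R => f (u + s *: h)) (fun s : R => s * c) 0 _ _ hg hl.
rewrite mulrC -e; apply: (congr1 (fun F : R -> R => 'D_(1 : R) F 0)); apply/funext => t /=.
by rewrite scalerA.
Qed.

(** The increment along v + h is one along v followed by one along h, whose starting
    point moves with t. *)
Lemma gateauxD f u v h : curve_C1 f -> U u ->
  gateaux (v + h) f u = gateaux v f u + gateaux h f u.
Proof.
move=> hf Uu.
have q1 := diff_quotient0 hf Uu (cst0 u) (cst0 (v + h)).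
have q2 := diff_quotient0 hf Uu (cst0 u) (cst0 v).
have gu : scvg (0 : R)^' (fun t : R => u + t *: v) u.
  rewrite -[X in scvg _ _ X]addr0 -(scale0r v); apply: scvgD; first exact: cst0.
  by apply: scvgZ; [exact: dnbhs_cvg0|exact: cst0].
have q3 := diff_quotient0 hf Uu gu (cst0 h).
apply: (cvgR_unique q1).
rewrite (_ : (fun t : R => _) = (fun t : R => t^-1 * (f (u + t *: v) - f u) +
  t^-1 * (f (u + t *: v + t *: h) - f (u + t *: v)))); first exact: cvgD.
by apply/funext => t; rewrite -mulrDr (addrC (f _ - f u)) addrA subrK scalerDr addrA.
Qed.

Context (K : C -> R) (smK : frechet_smooth_on U K).

Lemma curve_C1_K : curve_C1 K.
Proof.
split=> [u v|T F FF g v u v0 Uu gu vv]; first exact: smooth_derivable0 smK _ _.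
by apply: (smooth_continuous1 smK) => //; exact: scvg_cvg.
Qed.

Lemma curve_C1_gateaux h : curve_C1 (gateaux h K).
Proof.
split=> [u v|T F FF g v u v0 Uu gu vv]; first exact: smooth_derivable1 smK _ _ _.
by apply: (smooth_continuous2 smK) => //; [exact: scvg_cvg|exact: scvg_cvg|exact: cvg_cst].
Qed.

Context (Q L : C -> C) (Q0 : Q 0 = 0) (U0 : U 0).
Hypothesis KQ : \forall u \near (0 : C), K (Q u) = 0.
Hypothesis dQ0 : forall h, scvg (0 : R)^' (fun t => t^-1 *: Q (t *: h)) (L h).

Let c0 := dnbhs_cvg0.
Let cn := near_dnbhs_neq0.

Let line0 h : scvg (0 : R)^' (fun t => t *: h) 0.
Proof. by rewrite -(scale0r h); apply: scvgZ; [exact: dnbhs_cvg0|exact: cst0]. Qed.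

Let zero0 : (fun=> 0 : R) @ (0 : R)^' --> (0 : R).
Proof. exact: cvg_cst. Qed.

Lemma constraint_first_order h : gateaux (L h) K 0 = 0.
Proof.
have q := diff_quotient0 curve_C1_K U0 (cst0 0) (dQ0 h).
apply: (cvgR_unique q).
apply: cvg_trans zero0; apply: near_eq_cvg.
have K0 : K 0 = 0 by have := nbhs_singleton KQ; rewrite Q0.
have nK : \forall t \near (0 : R)^', K (Q (t *: h)) = 0 := scvg_near0 (line0 h) KQ.
apply: filterS2 cn nK => t t0 /= e.
by rewrite add0r scalerA mulfV // scale1r e K0 subrr mulr0.
Qed.

(** Write DK_t for the derivative of K at Q(t v), which kills M_t.  Then
    DK_t((M_t - L h) / t) = - (DK_t(L h) - DK_0(L h)) / t, as DK_0(L h) = 0.  The left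
    side tends to DK_0(W).  The right side tends to the second derivative of K at 0 in
    the directions L h and lim Q(t v) / t = L v = 0, so it tends to 0. *)
Lemma constraint_second_order v h (M : R -> C) (W : C) : L v = 0 ->
  (forall t : R, scvg (0 : R)^' (fun s => s^-1 *: (Q (t *: v + s *: h) - Q (t *: v))) (M t)) ->
  scvg (0 : R)^' (fun t => t^-1 *: (M t - L h)) W ->
  gateaux W K 0 = 0.
Proof.
move=> Lv dM dW.
have Qv : scvg (0 : R)^' (fun t => Q (t *: v)) 0.
  rewrite -(scale0r (L v)); apply: scvg_near (scvgZ c0 (dQ0 v)).
  by apply: filterS cn => t t0; rewrite scalerA mulfV // scale1r.
have UQ : \forall t \near (0 : R)^', U (Q (t *: v)).
  by apply: (scvg_near0 Qv); apply: open_nbhs_nbhs; split.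
have K2 : \forall u \near (0 : C), \forall w \near u, K (Q w) = 0.
  exact: nbhs_interior.
have KM : \forall t \near (0 : R)^', gateaux (M t) K (Q (t *: v)) = 0.
  have K2' : \forall t \near (0 : R)^', \forall w \near t *: v, K (Q w) = 0.
    exact: (scvg_near0 (line0 v) K2).
  apply: filterS2 UQ K2' => t UQt K2t.
  have q := diff_quotient0 curve_C1_K UQt (cst0 (Q (t *: v))) (dM t).
  apply: (cvgR_unique q).
  apply: cvg_trans zero0; apply: near_eq_cvg.
  have hs : scvg (0 : R)^' (fun s => t *: v + s *: h) (t *: v).
    by rewrite -[X in scvg _ _ X]addr0; apply: scvgD => //; exact: cst0.
  have e0 := nbhs_singleton K2t.
  have Ks : \forall s \near (0 : R)^', K (Q (t *: v + s *: h)) = 0 := scvg_near0 hs K2t.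
  apply: filterS2 cn Ks => s s0 /= e.
  by rewrite scalerA mulfV // scale1r (addrC (Q _)) subrK e e0 subrr mulr0.
have q1 : gateaux (t^-1 *: (M t - L h)) K (Q (t *: v)) @[t --> (0 : R)^'] -->
    gateaux W K 0 by exact: (curve_C1_K.2 _ _ _ _ _ _ _ U0 Qv dW).
have q2 := diff_quotient0 (curve_C1_gateaux (L h)) U0 (cst0 0) (dQ0 v).
rewrite Lv gateaux0 in q2.
apply: (cvgR_unique q1).
have q3 : - (t^-1 * (gateaux (L h) K (0 + t *: (t^-1 *: Q (t *: v))) - gateaux (L h) K 0))
    @[t --> (0 : R)^'] --> (0 : R).
  by rewrite -[X in _ --> X]oppr0; exact: cvgN.
apply: cvg_trans q3; apply: near_eq_cvg.
apply: filterS3 cn UQ KM => t t0 UQt KMt.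
rewrite add0r scalerA mulfV // scale1r constraint_first_order subr0.
have e : M t = L h + t *: (t^-1 *: (M t - L h)).
  by rewrite scalerA mulfV // scale1r (addrC (L h)) subrK.
move: KMt; rewrite {1}e (gateauxD _ _ curve_C1_K) // (gateauxZ _ _ curve_C1_K) //.
move=> /eqP; rewrite addrC addr_eq0 => /eqP h1.
by rewrite -(mulKf t0 (gateaux (t^-1 *: _) K _)) h1 mulrN.
Qed.

End calculus_along_curves.

(** * Derivatives of the Q-curvature *)

Section difference_quotients.
Context {R : realType} {n : nat}.
Local Notation C := (Csmooth R n).
Local Notation "u ** v" := (csmooth_mul u v) (at level 40, left associativity).
Implicit Types (u v h : C) (c d : R -> C).

Let F0 := (0 : R)^'.
Let near0 c d u : (\forall t \near F0, c t = d t) -> scvg F0 c u -> scvg F0 d u.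
Proof. exact: scvg_near. Qed.
Let eq0 c d u : (forall t, c t = d t) -> scvg F0 c u -> scvg F0 d u.
Proof. by move=> cd; apply: near0; exact: filterE. Qed.
Let cst0 u : scvg F0 (fun=> u) u. Proof. exact: scvg_cst. Qed.
Let scvgD0 c d u v : scvg F0 c u -> scvg F0 d v -> scvg F0 (fun t => c t + d t) (u + v).
Proof. exact: scvgD. Qed.
Let scvgM0 c d u v : scvg F0 c u -> scvg F0 d v -> scvg F0 (fun t => c t ** d t) (u ** v).
Proof. exact: scvgM. Qed.
Let scvgZ0 c u : scvg F0 c u -> scvg F0 (fun t => t *: c t) (0 *: u).
Proof. by apply: scvgZ; exact: dnbhs_cvg0. Qed.
Let jcvgM0 k c d u v : jcvg F0 k c u -> jcvg F0 k d v -> jcvg F0 k (fun t => c t ** d t) (u ** v).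
Proof. exact: jcvgM. Qed.

Let exp0 c u : scvg F0 c u -> scvg F0 (fun t => csmooth_exp (c t)) (csmooth_exp u).
Proof. exact: scvg_exp. Qed.

(** [u] is the derivative at 0 of the curve [c] in C^oo(S^n). *)
Definition is_dq c u := scvg (0 : R)^' (fun t => t^-1 *: (c t - c 0)) u.

Lemma is_dq_scvg c u : is_dq c u -> scvg (0 : R)^' c (c 0).
Proof.
move=> hc; have := scvgD0 (cst0 (c 0)) (scvgZ0 hc).
rewrite scale0r addr0; apply: near0; apply: filterS near_dnbhs_neq0 => t t0.
by rewrite scalerA mulfV // scale1r (addrC (c 0)) subrK.
Qed.

Lemma is_dq_cst u : is_dq (fun=> u) 0.
Proof. by rewrite /is_dq subrr; under eq_fun do rewrite scaler0; exact: cst0. Qed.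

Lemma is_dqD c d u v : is_dq c u -> is_dq d v -> is_dq (fun t => c t + d t) (u + v).
Proof.
move=> hc hd; have := scvgD0 hc hd; rewrite /is_dq; apply: eq0 => t.
by rewrite -scalerDr opprD addrACA.
Qed.

Lemma is_dqZ (a : R) c u : is_dq c u -> is_dq (fun t => a *: c t) (a *: u).
Proof.
move=> /(scvgZr (FF := _) a); rewrite /is_dq; apply: eq0 => t.
by rewrite -scalerBr !scalerA mulrC.
Qed.

Lemma is_dqM c d u v : is_dq c u -> is_dq d v ->
  is_dq (fun t => c t ** d t) (u ** d 0 + c 0 ** v).
Proof.
move=> hc hd; have := scvgD0 (scvgM0 hc (is_dq_scvg hd)) (scvgM0 (cst0 (c 0)) hd).
rewrite /is_dq; apply: eq0 => t.
apply: ev_ext => p; rewrite !evE.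
by move: (ev (c t) p) (ev (c 0) p) (ev (d t) p) (ev (d 0) p) => x y z w; ring.
Qed.

Lemma is_dq_paneitz0 m c u : is_dq c u -> is_dq (fun t => paneitz0 m (c t)) (paneitz0 m u).
Proof.
move=> /(scvg_paneitz0 m); rewrite /is_dq; apply: eq0 => t.
by rewrite paneitz0Z paneitz0D -scaleN1r paneitz0Z scaleN1r.
Qed.

Lemma is_dq_line u h : is_dq (fun t => u + t *: h) h.
Proof.
apply: near0 (cst0 h); apply: filterS near_dnbhs_neq0 => t t0.
by rewrite scale0r addr0 addrAC subrr add0r scalerA mulVf // scale1r.
Qed.

Lemma tderivB i u v : tderiv i (u - v) = tderiv i u - tderiv i v.
Proof. exact: raddfB. Qed.

Lemma tderiv0 i : tderiv i 0 = 0 :> C.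
Proof. exact: raddf0. Qed.

(** Order 0 is the second order Taylor bound.  A tangential derivative turns the
    quotient (e^(t h) - 1) / t into e^(t h) tderiv h, which is no longer a quotient,
    so the higher orders follow from convergence of exponentials. *)
Lemma is_dq_exp0 h : is_dq (fun t => csmooth_exp (t *: h)) h.
Proof.
have key k : jcvg F0 k (fun t : R => t^-1 *: (csmooth_exp (t *: h) - csmooth_exp (0 *: h))) h.
  have base : ucvg setT F0 (fun t : R => ev (t^-1 *: (csmooth_exp (t *: h) - csmooth_exp (0 *: h)))) (ev h).
    have [M0 hM0] := ev_bounded h; pose M := `|M0|.
    have hM p : `|ev h p| <= M by exact: le_trans (hM0 p) (ler_norm _).
    have M_ge0 : 0 <= M by exact: normr_ge0.
    move=> e e0; pose K := M ^+ 2 * expR M + 1.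
    have K0 : 0 < K by rewrite ltr_wpDl // mulr_ge0 ?sqr_ge0 ?expR_ge0.
    have nd : \forall t \near (0 : R)^', `|t| < Num.min 1 (e / K).
      have d0 : 0 < Num.min 1 (e / K) by rewrite lt_min ltr01 divr_gt0.
      have /cvgrPdist_lt/(_ _ d0) := @dnbhs_cvg0 R; apply: filterS => t.
      by rewrite sub0r normrN.
    apply: filterS2 nd near_dnbhs_neq0 => t; rewrite lt_min => /andP[t1 te] t0 p _.
    rewrite !evE mul0r expR0; set x := t * ev h p.
    have -> : t^-1 * (expR x - 1) - ev h p = t^-1 * (expR x - 1 - x).
      by rewrite [in RHS]mulrBr mulKf.
    rewrite normrM normfV ltr_pdivrMl ?normr_gt0 //.
    apply: le_lt_trans (norm_expRB1x x) _.
    have xM : `|x| <= `|t| * M by rewrite normrM ler_wpM2l.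
    have xM1 : `|x| <= M.
      by apply: le_trans xM _; apply: ler_piMl => //; exact: ltW.
    have x2 : x ^+ 2 <= `|t| ^+ 2 * M ^+ 2.
      by rewrite -exprMn -(real_normK (num_real x)) ler_pXn2r ?nnegrE ?mulr_ge0.
    apply: (@le_lt_trans _ _ (`|t| ^+ 2 * M ^+ 2 * expR M)).
      by apply: ler_pM; [exact: sqr_ge0|exact: expR_ge0|exact: x2|rewrite ler_expR].
    rewrite expr2 -!mulrA ltr_pM2l ?normr_gt0 //.
    apply: (@le_lt_trans _ _ (`|t| * K)); last by rewrite -ltr_pdivlMr.
    by apply: ler_wpM2l => //; rewrite /K expr2 -mulrA lerDl.
  case: k => [|k]; split => // i.
  have := jcvgM0 (exp0 (scvgZ0 (cst0 h)) k) (cst0 (tderiv i h) k).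
  rewrite scale0r (_ : csmooth_exp 0 ** _ = tderiv i h); last first.
    by apply: ev_ext => p; rewrite !evE expR0 mul1r.
  apply: jcvg_near; apply: filterS near_dnbhs_neq0 => t t0.
  rewrite tderivZ tderivB !tderiv_exp !tderivZ.
  apply: ev_ext => p; rewrite tderiv0 !evE mulr0 subr0.
  by rewrite mulrCA mulKf.
exact: key.
Qed.

Lemma is_dq_exp u h : is_dq (fun t => csmooth_exp (u + t *: h)) (csmooth_exp u ** h).
Proof.
have := is_dqM (is_dq_cst (csmooth_exp u)) (is_dq_exp0 h).
have -> : 0 ** csmooth_exp (0 *: h) + csmooth_exp u ** h = csmooth_exp u ** h.
  by apply: ev_ext => p; rewrite !evE mul0r add0r.
rewrite /is_dq; apply: eq0 => t.
by apply: ev_ext => p; rewrite !evE mul0r addr0 expR0 expRD mulr1.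
Qed.

End difference_quotients.

Section Q_curvature_expansion.
Context {R : realType} {n : nat}.
Local Notation C := (Csmooth R n).
Local Notation "u ** v" := (csmooth_mul u v) (at level 40, left associativity).
Implicit Types (u v h : C).
(* In the application E u is u or (e^(b u) - 1) / b; both have derivative e^(b u) h
   in the direction h, where b = 0 in the first case. *)
Variables (m : nat) (a b beta kappa : R) (E : C -> C).
Hypothesis E0 : E 0 = 0.
Hypothesis dE : forall u h, is_dq (fun t => E (u + t *: h)) (csmooth_exp (b *: u) ** h).

Lemma paneitz00 : paneitz0 m 0 = 0 :> C.
Proof. by have := paneitz0Z m 0 (0 : C); rewrite !scale0r. Qed.

(** The common form of the Q-curvature increment in the critical dimension n = 2m and
    in the other ones. *)
Definition Qgen u : C :=
  csmooth_exp (- a *: u) ** (csmooth_cst kappa + beta *: paneitz0 m (E u)) - csmooth_cst kappa.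

Definition dQgen u h : C :=
  csmooth_exp (- a *: u) ** (beta *: paneitz0 m (csmooth_exp (b *: u) ** h) -
    a *: (h ** (csmooth_cst kappa + beta *: paneitz0 m (E u)))).

Lemma is_dq_expZ (c : R) u h : is_dq (fun t => csmooth_exp (c *: (u + t *: h)))
  (c *: (csmooth_exp (c *: u) ** h)).
Proof.
have := is_dq_exp (c *: u) (c *: h).
have -> : csmooth_exp (c *: u) ** (c *: h) = c *: (csmooth_exp (c *: u) ** h).
  by apply: ev_ext => p; rewrite !evE mulrCA.
rewrite (_ : (fun t : R => csmooth_exp (c *: (u + t *: h))) =
  (fun t : R => csmooth_exp (c *: u + t *: (c *: h)))) //.
by apply/funext => t; rewrite scalerDr !scalerA (mulrC c).
Qed.

Lemma is_dq_Qgen u h : is_dq (fun t => Qgen (u + t *: h)) (dQgen u h).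
Proof.
have h1 := is_dqD (is_dq_cst (csmooth_cst kappa)) (is_dqZ beta (is_dq_paneitz0 m (dE u h))).
have := is_dqD (is_dqM (is_dq_expZ (- a) u h) h1) (is_dq_cst (- csmooth_cst kappa)).
rewrite scale0r !addr0 add0r.
rewrite (_ : _ + _ = dQgen u h) //.
apply: ev_ext => p; rewrite !evE.
by move: (ev _ _) (ev h p) (ev (paneitz0 _ _) _) (ev _ _) => x y z w; ring.
Qed.

Lemma dQgen0 h : dQgen 0 h = beta *: paneitz0 m h - (a * kappa) *: h.
Proof.
rewrite /dQgen E0 !scaler0.
rewrite paneitz00.
have -> : csmooth_exp 0 ** h = h by apply: ev_ext => p; rewrite !evE expR0 mul1r.
by apply: ev_ext => p; rewrite !evE expR0; move: (ev _ _) (ev _ _) => x y; ring.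
Qed.

Lemma is_dq_dQgen v h : is_dq (fun t => dQgen (t *: v) h)
  ((beta * b) *: paneitz0 m (v ** h) - (a * beta) *: (h ** paneitz0 m v) -
     a *: (v ** (beta *: paneitz0 m h - (a * kappa) *: h))).
Proof.
have hE := dE 0 v; have e1 := is_dq_expZ (- a) 0 v; have e2 := is_dq_expZ b 0 v.
have h1 := is_dqD (is_dq_cst (csmooth_cst kappa)) (is_dqZ beta (is_dq_paneitz0 m hE)).
have h2 := is_dqZ (- a) (is_dqM (is_dq_cst h) h1).
have h3 := is_dqZ beta (is_dq_paneitz0 m (is_dqM e2 (is_dq_cst h))).
have := is_dqM e1 (is_dqD h3 h2).
rewrite /is_dq; set W := (X in scvg _ _ X) => hW; set V := (X in scvg _ _ X).
suff -> : V = W.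
  apply: scvg_near hW; apply: filterE => t.
  by rewrite /dQgen !add0r !scaleNr.
rewrite /V /W {V W hW}.
rewrite !scale0r !addr0 !scaler0 E0.
have x0 u : csmooth_exp 0 ** u = u by apply: ev_ext => p; rewrite !evE expR0 mul1r.
have z0 u : u ** 0 = 0 by apply: ev_ext => p; rewrite !evE mulr0.
have z0' u : 0 ** u = 0 by apply: ev_ext => p; rewrite !evE mul0r.
rewrite ?x0 ?z0 ?z0' ?x0 ?addr0 ?add0r paneitz00 scaler0 addr0.
have -> : paneitz0 m ((b *: v) ** h) = b *: paneitz0 m (v ** h).
  rewrite -paneitz0Z; congr paneitz0; apply: ev_ext => p; rewrite !evE.
  by rewrite mulrA.
apply: ev_ext => p; rewrite !evE.
by move: (ev v p) (ev h p) (ev _ _) (ev _ _) (ev _ _) => x y z w t; ring.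
Qed.

End Q_curvature_expansion.

(** * Bernstein operators on the cube *)

Section bernstein.
Context {R : realType} {d : nat}.
Local Notation V := 'rV[R]_d.
Implicit Types (x y z v : V) (i j : 'I_d) (w s : seq 'I_d) (F G H : V -> R).

(** The affine map from [-1,1] onto [0,1]. *)
Definition tau (x : V) i : R := (x 0 i + 1) / 2.

(** The expectation of [G] at the end of a random walk that starts at [y] and, for each
    letter i of [w], moves by h e_i with probability tau x i.  For
    y = (-1, ..., -1), h = 2/N and a word containing each letter N times, this is the
    tensor product Bernstein polynomial of [G] on the cube.  The recursion replaces
    sums over binomial distributions by inductions on the word. *)
Fixpoint bern (h : R) w G y x : R :=
  if w is i :: w' then
    (1 - tau x i) * bern h w' G y x + tau x i * bern h w' G (y + h *: basis_vec i) x
  else G y.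

Variable h : R.

Lemma bern_shift w G v y x : bern h w (fun z => G (z + v)) y x = bern h w G (y + v) x.
Proof. by elim: w y => //= i w IH y; rewrite !IH addrAC. Qed.

Lemma bernD w G H y x :
  bern h w (fun z => G z + H z) y x = bern h w G y x + bern h w H y x.
Proof. by elim: w y => //= i w IH y; rewrite !IH; ring. Qed.

Lemma bernZ w (c : R) G y x : bern h w (fun z => c * G z) y x = c * bern h w G y x.
Proof. by elim: w y => //= i w IH y; rewrite !IH; ring. Qed.

Lemma bern_cst w (c : R) y x : bern h w (fun=> c) y x = c.
Proof. by elim: w y => //= i w IH y; rewrite !IH; ring. Qed.

Lemma bern_sum w (G : 'I_d -> V -> R) y x :
  bern h w (fun z => \sum_i G i z) y x = \sum_i bern h w (G i) y x.
Proof.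
elim: (index_enum _) => [|i r IH].
  by rewrite big_nil; under eq_fun do rewrite big_nil; exact: bern_cst.
by rewrite big_cons -IH; under eq_fun do rewrite big_cons; exact: bernD.
Qed.

(** Only the points that the walk can reach matter. *)
Lemma bern_le w G H y x : 0 <= h -> box 1 x ->
  (forall z, (forall i, y 0 i <= z 0 i <= y 0 i + h * (count_mem i w)%:R) -> G z <= H z) ->
  bern h w G y x <= bern h w H y x.
Proof.
move=> h0 bx; elim: w y => [|i w IH] y GH /=.
  by apply: GH => i; rewrite mulr0 addr0 lexx.
have [t0 t1] : 0 <= tau x i /\ tau x i <= 1.
  by have := bx i; rewrite ler_norml => /andP[a b]; rewrite /tau; split; lra.
have hi j : 0 <= h * ((i == j) : nat)%:R by rewrite mulr_ge0.
apply: lerD; apply: ler_wpM2l; rewrite ?subr_ge0 //; apply: IH => z hz; apply: GH => j;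
  have /andP[z1 z2] := hz j; have := hi j; rewrite /= natrD mulrDr.
  by move=> hij; apply/andP; split; lra.
move: z1 z2; rewrite !mxE eqxx /= eq_sym => z1 z2 hij; apply/andP; split; lra.
Qed.

(** The squared bias plus the variance of the i-th coordinate of the walk. *)
Lemma bern_moment w i (a : R) y x :
  let t := tau x i in let c := (count_mem i w)%:R in
  bern h w (fun z => (z 0 i - a) ^+ 2) y x =
  (y 0 i + h * c * t - a) ^+ 2 + c * h ^+ 2 * t * (1 - t).
Proof.
move=> /=; elim: w y => [|j w IH] y /=; first by rewrite mulr0 !mul0r !addr0.
rewrite !IH !mxE eqxx /= natrD eq_sym.
have [->|ij] := eqVneq i j; rewrite ?mulr1n ?mulr0n; ring.
Qed.

Lemma bern_swap w i j G y x : bern h (i :: j :: w) G y x = bern h (j :: i :: w) G y x.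
Proof. by rewrite /= addrAC; ring. Qed.

(** The order of the steps is irrelevant. *)
Lemma bern_rem w i G y x : i \in w -> bern h (i :: rem i w) G y x = bern h w G y x.
Proof.
elim: w y => //= j w IH y; rewrite inE; have [->|ij] := eqVneq j i => //.
move=> /= iw; have := bern_swap (rem i w) i j G y x; rewrite /= => ->.
by rewrite -!(IH _ iw).
Qed.

Lemma is_derive_tau x i j :
  is_derive x (basis_vec i) (fun x : V => tau x j) ((i == j)%:R / 2).
Proof.
have hj := is_derive_coord x (basis_vec i) j; rewrite mxE eqxx /= eq_sym in hj.
by rewrite /tau; apply: is_derive_eq; rewrite /GRing.scale /=; ring.
Qed.

(** The derivative of a Bernstein polynomial is the Bernstein polynomial of a finite
    difference, with one step less; the factor 1/2 is the derivative of [tau]. *)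
Lemma is_derive_bern w i G y x :
  is_derive x (basis_vec i) (bern h w G y)
   ((count_mem i w)%:R / 2 *
    bern h (rem i w) (fun z => G (z + h *: basis_vec i) - G z) y x).
Proof.
elim: w y => [|j w IH] y.
  by rewrite /= mul0r mul0r; exact: is_derive_cst.
have ht := is_derive_tau x i j.
have h1 := IH y; have h2 := IH (y + h *: basis_vec j).
rewrite [bern h (j :: w) G y](_ : _ = fun x => (1 - tau x j) * bern h w G y x +
  tau x j * bern h w G (y + h *: basis_vec j) x) //.
apply: is_derive_eq; rewrite /GRing.scale /=.
set D := (fun z : V => _) in h1 h2 *.
have [e|ji] := eqVneq j i; last by rewrite /= add0n; ring.
rewrite e in h1 h2 *; rewrite add1n -(natr1 (count_mem i w)) mulr1n.
have e2 : bern h w D y x = bern h w G (y + h *: basis_vec i) x - bern h w G y x.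
  rewrite -bern_shift -[- bern _ _ _ _ _]mulN1r -bernZ -bernD; congr bern.
  by apply/funext => z; rewrite mulN1r.
have [iw|iw] := boolP (i \in w); last by rewrite (count_memPn iw) e2; ring.
have e1 := bern_rem D y x iw; rewrite /= in e1.
rewrite [RHS](_ : _ = (count_mem i w)%:R / 2 * bern h w D y x + 2^-1 * bern h w D y x).
  by rewrite -{1}e1 e2; ring.
by ring.
Qed.

End bernstein.

(** * Convergence of Bernstein operators *)

Section moduli.
Context {R : realType} {d : nat}.
Local Notation V := 'rV[R]_d.
Implicit Types (x y z v : V) (i j : 'I_d) (w s : seq 'I_d) (F G H : V -> R).

Lemma sqr_norm_le x : `|x| ^+ 2 <= \sum_i x 0 i ^+ 2.
Proof.
have [->|x0] := eqVneq `|x| 0.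
  by rewrite expr0n; apply: sumr_ge0 => *; exact: sqr_ge0.
have [[k i] /= e] := mx_norm_neq0 x0; rewrite [`|x|]e (ord1 k) real_normK ?num_real //.
by rewrite (bigD1 i) //= lerDl; apply: sumr_ge0 => *; exact: sqr_ge0.
Qed.

Lemma norm_basis_vec i : `|basis_vec i : V| <= 1.
Proof.
have [->|x0] := eqVneq `|basis_vec i : V| 0; first exact: ler01.
have [[k j] /= e] := mx_norm_neq0 x0; rewrite [`|_|]e mxE.
by case: (_ && _); rewrite ?normr1 ?normr0 ?ler01.
Qed.

Lemma box_bounded c G : continuous G -> exists M, forall x, box c x -> `|G x| <= M.
Proof.
move=> cG; have : compact (G @` box c).
  by have cb := @compact_box R d c; apply: continuous_compact cb; apply: continuous_subspaceT.
move=> /compact_bounded [M [_ hM]]; exists (M + 1) => p bp; apply: hM; first by rewrite ltrDl.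
by exists p.
Qed.

Lemma box_unif_continuous c G (e : R) : continuous G -> 0 < e ->
  exists2 r : R, 0 < r & forall x z, box c x -> `|z - x| < r -> `|G z - G x| <= e.
Proof.
move=> cG e0.
pose P (r : R) x := forall z, `|z - x| < r -> `|G z - G x| <= e.
have : \forall r \near (0 : R)^'+, box c `<=` P r.
  apply: (@compact_near_coveringP _ (box c)).1 => [|x bx]; first exact: compact_box.
  have /cvgrPdist_lt/(_ _ (divr_gt0 e0 (ltr0n _ 2))) := cG x.
  move=> /nbhs_ballP[r /= r0 hr].
  have r2 : 0 < r / 2 by rewrite divr_gt0.
  exists (ball x (r / 2), [set t : R | t < r / 2]) => /=.
    split; first exact: nbhsx_ballx.
    exact: nbhs_right_lt.
  move=> [x' t] /= [bx' tr] z zx'.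
  rewrite -ball_normE /= in bx' hr.
  have h1 : `|G x - G x'| < e / 2.
    by apply: hr => /=; apply: lt_trans bx' _; lra.
  have h2 : `|G x - G z| < e / 2.
    apply: hr => /=; rewrite -(subrKA x'); apply: le_lt_trans (ler_normD _ _) _.
    have tr' : t < r / 2 := tr.
    rewrite (distrC z) in zx'; rewrite (splitr r); apply: ltrD; first exact: bx'.
    exact: lt_trans zx' tr'.
  rewrite -(subrKA (G x)) (splitr e); apply: le_trans (ler_normD _ _) _.
  by apply: lerD; [rewrite distrC|]; exact: ltW.
move=> h; near (0 : R)^'+ => r; exists r.
  by near: r; exact: nbhs_right_gt.
have hr : box c `<=` P r by near: r.
by move=> x z bx; exact: hr.
Unshelve. all: by end_near.
Qed.

(** Uniform continuity handles the close points and boundedness the distant ones.  With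
    a quadratic remainder, second moments suffice to bound expectations. *)
Lemma quadratic_modulus c G (e : R) : continuous G -> 0 < e ->
  exists2 K : R, 0 <= K & forall x z, box c x -> box c z ->
    `|G z - G x| <= e + K * \sum_i (z 0 i - x 0 i) ^+ 2.
Proof.
move=> cG e0; have [r r0 hr] := box_unif_continuous c cG e0.
have [M hM] := box_bounded c cG; have M0 := normr_ge0 M.
have K0 : 0 <= 2 * `|M| / r ^+ 2.
  by rewrite divr_ge0 ?sqr_ge0 // mulr_ge0.
exists (2 * `|M| / r ^+ 2) => //.
move=> x z bx bz; have [zx|zx] := ltP `|z - x| r.
  apply: le_trans (hr x z bx zx) _; rewrite lerDl mulr_ge0 //.
  by apply: sumr_ge0 => *; exact: sqr_ge0.
have h1 : `|G z - G x| <= 2 * `|M|.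
  apply: le_trans (ler_normB _ _) _; have := hM x bx; have := hM z bz.
  by have := ler_norm M; lra.
have h2 : r ^+ 2 <= \sum_i (z 0 i - x 0 i) ^+ 2.
  apply: le_trans (_ : `|z - x| ^+ 2 <= _); first by rewrite ler_pXn2r ?nnegrE // ltW.
  apply: le_trans (sqr_norm_le (z - x)) _; apply: ler_sum => i _.
  by rewrite !mxE.
apply: le_trans h1 _; apply: ler_wpDl; first exact: ltW.
rewrite mulrAC -mulrA ler_peMr ?mulr_ge0 //.
by rewrite ler_pdivlMr ?mul1r ?exprn_gt0.
Qed.

End moduli.

Section bernstein_limit.
Context {R : realType} {d : nat}.
Local Notation V := 'rV[R]_d.
Implicit Types (x y z v : V) (i j : 'I_d) (s : seq 'I_d) (F G : V -> R).

(** The side of the cube divided into N + 1 steps. *)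
Definition step (N : nat) : R := 2 / N.+1%:R.

Let y0 : V := const_mx (-1).

(** Each derivation of a Bernstein polynomial removes a letter, so the number of steps
    in a given direction is N + 1 only asymptotically.  The upper bound keeps the walk
    inside the cube. *)
Definition balanced (w : nat -> seq 'I_d) := forall i,
  (forall N, (count_mem i (w N) <= N.+1)%N) /\
  (count_mem i (w N))%:R / N.+1%:R @[N --> \oo] --> (1 : R).

Lemma step_gt0 N : 0 < step N.
Proof. by rewrite divr_gt0. Qed.

Lemma step_cvg0 : step N @[N --> \oo] --> (0 : R).
Proof.
rewrite -(mulr0 2); apply: cvgM; first exact: cvg_cst.
exact: cvg_harmonic.
Qed.

(** [H N] is compared with functions U c of the form G x + c (e/2 + K |z - x|^2), whose
    expectations are given by [bern_moment].  The bias of the i-th coordinate is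
    2 (r - 1) tau and its variance 2 r step tau (1 - tau), where r is the number of
    letters i divided by N + 1; both tend to 0 uniformly in x. *)
Lemma bern_cvg (w : nat -> seq 'I_d) (H : nat -> V -> R) G : balanced w ->
  continuous G -> ucvg (box 1) \oo H G ->
  ucvg (box 1) \oo (fun N x => bern (step N) (w N) (H N) y0 x) G.
Proof.
move=> bw cG HG e e0.
have e3 : 0 < e / 4 by rewrite divr_gt0.
have [K K0 hK] := quadratic_modulus 1 cG e3.
pose r N i : R := (count_mem i (w N))%:R / N.+1%:R.
pose err N : R := \sum_i ((2 * (r N i - 1)) * (2 * (r N i - 1)) + r N i * (step N * 2)).
have err0 : K * err N @[N --> \oo] --> (0 : R).
  rewrite -(mulr0 K); apply: cvgM; first exact: cvg_cst.
  rewrite /err; elim: (index_enum _) => [|i l IH].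
    by under eq_fun do rewrite big_nil; exact: cvg_cst.
  under eq_fun do rewrite big_cons.
  have [_ hr] := bw i.
  have h2 : 2 * (r N i - 1) @[N --> \oo] --> (2 * (1 - 1) : R).
    by apply: cvgM; [exact: cvg_cst|apply: cvgB => //; exact: cvg_cst].
  have h3 : r N i * (step N * 2) @[N --> \oo] --> (1 * (0 * 2) : R).
    by apply: cvgM => //; apply: cvgM; [exact: step_cvg0|exact: cvg_cst].
  have := cvgD (cvgD (cvgM h2 h2) h3) IH.
  rewrite subrr !(mulr0, mul0r) !addr0 => hs; exact: hs.
have /cvgrPdist_lt/(_ _ e3) en := err0.
apply: filterS2 (HG _ e3) en => N hH; rewrite sub0r normrN => he x bx.
have h0 := ltW (step_gt0 N).
pose U (c : R) z := G x + c * (e / 2 + K * \sum_i (z 0 i - x 0 i) ^+ 2).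
have hU z : (forall i, y0 0 i <= z 0 i <= y0 0 i + step N * (count_mem i (w N))%:R) ->
    U (-1) z <= H N z /\ H N z <= U 1 z.
  move=> hz; have bz : box 1 z.
    move=> i; have := hz i; rewrite mxE => /andP[z1 z2]; rewrite ler_norml z1 /=.
    apply: le_trans z2 _; rewrite -lerBrDl /step mulrAC ler_pdivrMr // opprK.
    by rewrite -(natrD _ 1 1) ler_wpM2l // ler_nat; have [] := bw i.
  have := hK x z bx bz; have := hH z bz; rewrite !ler_norml ltr_norml => /andP[a1 a2] /andP[b1 b2].
  rewrite /U; set S := K * _ in b1 b2 *; split; lra.
have eU c : bern (step N) (w N) (U c) y0 x = G x + c * (e / 2 + K *
    \sum_i ((2 * (r N i - 1)) ^+ 2 * tau x i ^+ 2 + r N i * (step N * 2) * (tau x i * (1 - tau x i)))).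
  rewrite /U bernD bern_cst bernZ bernD bern_cst bernZ bern_sum; congr (_ + _ * (_ + _ * _)).
  apply: eq_bigr => i _; rewrite bern_moment mxE /r /step.
  have N0 : (N.+1%:R : R) != 0 by rewrite pnatr_eq0.
  rewrite (_ : x 0 i = 2 * tau x i - 1); last by rewrite /tau; field.
  move: (tau x i) (_%:R) (N.+1%:R) N0 => t c' M M0; field.
  by [].
have t01 i : 0 <= tau x i <= 1.
  by have := bx i; rewrite ler_norml => /andP[a b]; rewrite /tau; apply/andP; split; lra.
have Eerr : \sum_i ((2 * (r N i - 1)) ^+ 2 * tau x i ^+ 2 +
    r N i * (step N * 2) * (tau x i * (1 - tau x i))) <= err N.
  apply: ler_sum => i _; have /andP[t0 t1] := t01 i.
  apply: lerD.
    by rewrite -expr2; apply: ler_piMr; [exact: sqr_ge0|rewrite expr_le1].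
  apply: ler_piMr; first by rewrite mulr_ge0 // ?divr_ge0 // mulr_ge0.
  by nra.
have KE := ler_wpM2l K0 Eerr.
have lo : bern (step N) (w N) (U (-1)) y0 x <= bern (step N) (w N) (H N) y0 x.
  by apply: bern_le => // z /hU [].
have hi : bern (step N) (w N) (H N) y0 x <= bern (step N) (w N) (U 1) y0 x.
  by apply: bern_le => // z /hU [].
move: lo hi; rewrite !eU; move: KE; set S := K * _ => KE.
have {}he : K * err N < e / 4 by apply: le_lt_trans (ler_norm _) he.
move: (bern _ _ _ _ _) => B lo hi; rewrite ltr_norml; apply/andP; split; lra.
Qed.

End bernstein_limit.

(** * Convergence of the derivatives of Bernstein polynomials *)

Section bernstein_derivatives.
Context {R : realType} {d : nat}.
Local Notation V := 'rV[R]_d.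
Implicit Types (x y z v : V) (i j : 'I_d) (s : seq 'I_d) (F G : V -> R).

Definition diffq (h : R) i F : V -> R := fun z => h^-1 * (F (z + h *: basis_vec i) - F z).

Lemma diffq_comm (h : R) i F s :
  foldr (diffq h) (diffq h i F) s = diffq h i (foldr (diffq h) F s).
Proof.
elim: s => //= j s ->; apply/funext => z; rewrite /diffq.
by rewrite (addrAC z); ring.
Qed.

Lemma is_derive_shift F v u x (D : R) :
  is_derive (x + v) u F D -> is_derive x u (fun x => F (x + v)) D.
Proof.
move=> /is_derive_line h; apply/is_derive_line.
by under eq_fun do rewrite -addrA.
Qed.

Lemma is_derive_diffq (h : R) i j F (F' : V -> R) :
  (forall x, is_derive x (basis_vec i) F (F' x)) ->
  forall x, is_derive x (basis_vec i) (diffq h j F) (diffq h j F' x).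
Proof.
move=> hF x; rewrite /diffq.
have h1 := is_derive_shift (hF (x + h *: basis_vec j)); have h2 := hF x.
by apply: is_derive_eq; rewrite /GRing.scale /=; ring.
Qed.

Lemma is_derive_diffqs (h : R) i s F (F' : V -> R) :
  (forall x, is_derive x (basis_vec i) F (F' x)) ->
  forall x, is_derive x (basis_vec i) (foldr (diffq h) F s) (foldr (diffq h) F' s x).
Proof. by elim: s => //= j s IH hF; apply: is_derive_diffq; exact: IH. Qed.

Lemma diffq_mean_value (h : R) i F (F' : V -> R) z : 0 < h ->
  (forall x, is_derive x (basis_vec i) F (F' x)) ->
  exists2 xi, `|xi - z| <= h & diffq h i F z = F' xi.
Proof.
move=> h0 hF; have [s /andP[s0 s1] e] : exists2 s : R, 0 <= s <= 1 &
    F (z + h *: basis_vec i) - F z = h * 'D_(basis_vec i) F (z + (s * h) *: basis_vec i).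
  by apply: line_mean_value => s _; have [] := hF (z + (s * h) *: basis_vec i).
exists (z + (s * h) *: basis_vec i).
  rewrite addrC addKr normrZ normrM (ger0_norm s0) (gtr0_norm h0).
  apply: le_trans (ler_piMr _ (norm_basis_vec i)) _; first by rewrite mulr_ge0 // ltW.
  by apply: ler_piMl => //; exact: ltW.
by rewrite /diffq e mulKf ?gt_eqF //; have [_] := hF (z + (s * h) *: basis_vec i).
Qed.

Lemma Ck_pderiv k F i : Ck k.+1 setT F -> Ck k setT (pderiv i F).
Proof. by move=> [_ h]; exact: h. Qed.

Lemma Ck_derive k F i : Ck k setT F ->
  forall x, is_derive x (basis_vec i) F (pderiv i F x).
Proof.
case: k => [|k] [h _] x; have [_ h2] := h x I; exact: DeriveDef.
Qed.

Lemma Ck_continuous k F : Ck k setT F -> continuous F.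
Proof. by case: k => [|k] [h _] x; have [] := h x I. Qed.

Lemma Ck_foldr s k F : Ck (size s + k) setT F -> Ck k setT (foldr pderiv F s).
Proof.
elim/last_ind: s F => [|s i IH] F //; rewrite size_rcons addSn foldr_rcons => /Ck_pderiv h.
exact: IH.
Qed.

(** Difference quotients commute with derivations, so the mean value theorem applies one
    letter at a time. *)
Lemma diffqs_mean_value (h : R) s F z : 0 < h -> Ck (size s) setT F ->
  exists2 xi, `|xi - z| <= (size s)%:R * h &
    foldr (diffq h) F s z = foldr pderiv F s xi.
Proof.
move=> h0; elim/last_ind: s F z => [|s i IH] F z hF.
  by exists z => //; rewrite subrr normr0 mul0r.
rewrite !foldr_rcons diffq_comm; rewrite size_rcons in hF *.
have dF := is_derive_diffqs h s (Ck_derive i hF).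
have [y yz ->] := diffq_mean_value z h0 dF.
have [xi hxi ->] := IH _ y (Ck_pderiv i hF).
exists xi => //; rewrite -(subrKA y) -natr1 mulrDl mul1r.
exact: le_trans (ler_normD _ _) (lerD hxi yz).
Qed.

Lemma diffqs_cvg s F : Ck (size s) setT F ->
  ucvg (box 1) \oo (fun N => foldr (diffq (step N)) F s) (foldr pderiv F s).
Proof.
move=> hF e e0.
have cG : continuous (foldr pderiv F s).
  by apply: (@Ck_continuous 0); apply: Ck_foldr; rewrite addn0.
have e2 : 0 < e / 2 by rewrite divr_gt0.
have [r r0 hr] := box_unif_continuous 1 cG e2.
have c0 : (size s)%:R * step N @[N --> \oo] --> (0 : R).
  by rewrite -(mulr0 (size s)%:R); apply: cvgM; [exact: cvg_cst|exact: step_cvg0].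
have /cvgrPdist_lt/(_ r r0) := c0; apply: filterS => N; rewrite sub0r normrN => hN z bz.
have [xi hxi ->] := diffqs_mean_value z (step_gt0 N) hF.
apply: (@le_lt_trans _ _ (e / 2)); last by rewrite ltr_pdivrMr // ltr_pMr // ltr1n.
apply: hr => //; apply: le_lt_trans hxi _; exact: le_lt_trans (ler_norm _) hN.
Qed.

Lemma balanced_rem w i : balanced (R := R) w -> balanced (R := R) (fun N => rem i (w N)).
Proof.
move=> bw j; have [b1 b2] := bw j; split.
  by move=> N; rewrite count_rem; apply: leq_trans (b1 N); exact: leq_subr.
have lo : (count_mem j (w N))%:R / N.+1%:R - N.+1%:R^-1 @[N --> \oo] --> (1 : R).
  by have := cvgB b2 (@cvg_harmonic R); rewrite subr0 => hs; exact: hs.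
apply: (squeeze_cvgr _ lo b2); apply: nearW => N; apply/andP; split.
  rewrite -[X in _ - X]mul1r -mulrBl ler_pM2r ?invr_gt0 // lerBlDr natr1 ler_nat count_rem.
  by case: (_ && _); lia.
by rewrite ler_pM2r ?invr_gt0 // ler_nat count_rem leq_subr.
Qed.

(** Induction on [s]: by [is_derive_bern] a derivation acts on [H N] as a difference
    quotient, removes a letter, and yields a factor tending to 1, which is absorbed in
    [c N]. *)
Lemma bern_derivs_cvg s (w : nat -> seq 'I_d) (c : nat -> R) (H : nat -> V -> R) G :
  balanced (R := R) w -> c N @[N --> \oo] --> (1 : R) -> continuous G ->
  ucvg (box 1) \oo (fun N => foldr (diffq (step N)) (H N) s) G ->
  ucvg (box 1) \oo (fun N => foldr pderiv
    (fun x => c N * bern (step N) (w N) (H N) (const_mx (-1)) x) s) G.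
Proof.
elim/last_ind: s w c H => [|s i IH] w c H bw c1 cG hH.
  have [M hM] := box_bounded 1 cG.
  have h1 : ucvg (box 1) \oo (fun N _ => c N) (fun _ : V => 1).
    move=> e e0; have /cvgrPdist_lt/(_ e e0) := c1; apply: filterS => N h x _.
    by rewrite distrC.
  apply: (ucvg_eqr (l := fun x => 1 * G x)); first by move=> x _; rewrite mul1r.
  apply: (ucvgM (M := `|M| + 1)) => //.
  - by move=> x _; rewrite normr1 lerDr.
  - by move=> x bx; apply: le_trans (hM x bx) _; rewrite (le_trans (ler_norm M)) // lerDl.
  - exact: bern_cvg.
pose r N : R := (count_mem i (w N))%:R / N.+1%:R.
have e N : pderiv i (fun x => c N * bern (step N) (w N) (H N) (const_mx (-1)) x) =
    fun x => (c N * r N) * bern (step N) (rem i (w N)) (diffq (step N) i (H N)) (const_mx (-1)) x.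
  apply/funext => x; rewrite /pderiv.
  have hd := is_derive_bern (step N) (w N) i (H N) (const_mx (-1)) x.
  have hd2 : is_derive x (basis_vec i) (fun x => c N * bern (step N) (w N) (H N) (const_mx (-1)) x)
     ((c N * r N) * bern (step N) (rem i (w N)) (diffq (step N) i (H N)) (const_mx (-1)) x).
    apply: is_derive_eq; rewrite /diffq bernZ -[LHS]/(c N * (_ * _)) /r.
    have N0 : (N.+1%:R : R) != 0 by rewrite pnatr_eq0.
    move: (bern _ _ _ _ _) => B; rewrite /step; move: (N.+1%:R) N0 => M M0; by field.
  by have [_ ->] := hd2.
under eq_fun do rewrite foldr_rcons e.
apply: IH => //; first exact: balanced_rem.
  by have := cvgM c1 (bw i).2; rewrite mulr1 => hs; exact: hs.
by move: hH; under eq_fun do rewrite foldr_rcons.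
Qed.

Definition all_steps (N : nat) : seq 'I_d := flatten (nseq N.+1 (enum 'I_d)).

Lemma balanced_all_steps : balanced (R := R) all_steps.
Proof.
move=> i; have e N : count_mem i (all_steps N) = N.+1.
  rewrite /all_steps count_flatten map_nseq sumn_nseq count_uniq_mem ?enum_uniq //.
  by rewrite mem_enum mul1n.
split=> [N|]; first by rewrite e.
under eq_fun do rewrite e divff ?pnatr_eq0 //.
exact: cvg_cst.
Qed.

Lemma bernstein_Ck k F : Ck k setT F -> forall s, (size s <= k)%N ->
  ucvg (box 1) \oo (fun N => foldr pderiv
    (bern (step N) (all_steps N) F (const_mx (-1))) s) (foldr pderiv F s).
Proof.
move=> hF s sk; have hFs : Ck (size s) setT F.
  by elim: k hF sk => [|k IH] hF; rewrite leq_eqVlt => /orP[/eqP->|] //; move/IH; apply; exact: CkW.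
have cG : continuous (foldr pderiv F s).
  by apply: (@Ck_continuous 0); apply: Ck_foldr; rewrite addn0.
have c1 : (fun _ : nat => 1 : R) @ \oo --> (1 : R) by exact: cvg_cst.
have := bern_derivs_cvg balanced_all_steps c1 cG (diffqs_cvg hFs).
by under eq_fun do under eq_fun do rewrite mul1r.
Qed.

End bernstein_derivatives.

(** * Directional derivatives from partial derivatives *)

Section partial_derivatives.
Context {R : realType} {d : nat}.
Local Notation V := 'rV[R]_d.
Implicit Types (x y z u v : V) (i j : 'I_d) (G : V -> R).

(** The base point z t moves, so that an increment can be split into increments along the
    coordinates. *)
Lemma partial_diff_quotient G u i (z : R -> V) (a : R) :
  (\forall x \near u, derivable G x (basis_vec i)) ->
  {for u, continuous (pderiv i G)} ->
  z t @[t --> (0 : R)^'] --> u ->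
  t^-1 * (G (z t + (t * a) *: basis_vec i) - G (z t)) @[t --> (0 : R)^'] -->
    a * pderiv i G u.
Proof.
move=> dG cG zu; apply/cvgrPdist_lt => e e0.
have K0 : 0 < `|a| + 1 by rewrite ltr_wpDl.
have eK : 0 < e / (`|a| + 1) by rewrite divr_gt0.
have /cvgrPdist_lt/(_ _ eK) hc := cG.
have : nbhs u [set x | derivable G x (basis_vec i) /\
    `|pderiv i G u - pderiv i G x| < e / (`|a| + 1)] by exact: filterI dG hc.
move=> /nbhs_ballP[r /= r0 hr].
have r2 : 0 < r / 2 by rewrite divr_gt0.
have /cvgrPdist_lt/(_ _ r2) hz := zu.
have ta0 : t * a @[t --> (0 : R)^'] --> (0 : R).
  by have := cvgM (@dnbhs_cvg0 R) (@cvg_cst _ a _ _ _); rewrite mul0r => hs; exact: hs.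
have /cvgrPdist_lt/(_ _ r2) ht := ta0.
apply: filterS3 hz ht (@near_dnbhs_neq0 R) => t zt tr t0.
have hB (s : R) : 0 <= s <= 1 -> ball u r (z t + (s * (t * a)) *: basis_vec i).
  move=> /andP[s0 s1]; rewrite -ball_normE /= opprD addrA.
  apply: le_lt_trans (ler_normB _ _) _; rewrite (splitr r); apply: ltrD => //.
  rewrite normrZ normrM (ger0_norm s0); move: tr; rewrite sub0r normrN.
  apply: le_lt_trans; rewrite -[leRHS]mulr1; apply: ler_pM => //.
  - by rewrite mulr_ge0.
  - exact: ler_piMl.
  - exact: norm_basis_vec.
have [s s01 ->] : exists2 s : R, 0 <= s <= 1 &
   G (z t + (t * a) *: basis_vec i) - G (z t) =
   (t * a) * pderiv i G (z t + (s * (t * a)) *: basis_vec i).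
  by apply: line_mean_value => s s01; have [] := hr _ (hB s s01).
rewrite -mulrA mulKf // -mulrBr normrM.
have [_ h] := hr _ (hB s s01).
apply: (@le_lt_trans _ _ (`|a| * (e / (`|a| + 1)))).
  by apply: ler_wpM2l => //; apply: ltW.
rewrite mulrA ltr_pdivrMr // [ltRHS]mulrC ltr_pM2r // ltrDl; exact: ltr01.
Qed.

Lemma directional_derivative G u v :
  (\forall x \near u, forall i, derivable G x (basis_vec i)) ->
  (forall i, {for u, continuous (pderiv i G)}) ->
  t^-1 * (G (u + t *: v) - G u) @[t --> (0 : R)^'] --> \sum_i v 0 i * pderiv i G u.
Proof.
move=> dG cG; have zu (r : seq 'I_d) : u + t *: (\sum_(i <- r) v 0 i *: basis_vec i) @[t --> (0 : R)^'] --> u.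
  set S := \sum_(i <- r) _; have h0 : t *: S @[t --> (0 : R)^'] --> (0 : V).
    have := cvgZr_tmp (a := S) (@dnbhs_cvg0 R); rewrite scale0r => hs; exact: hs.
  have := cvgD (cvg_cst u) h0; rewrite addr0 => hs; exact: hs.
suff h (r : seq 'I_d) : t^-1 * (G (u + t *: (\sum_(i <- r) v 0 i *: basis_vec i)) - G u) @[t --> (0 : R)^'] -->
    \sum_(i <- r) v 0 i * pderiv i G u.
  by have := h (index_enum _); rewrite -[in X in X -> _]row_sum_delta.
elim: r => [|i r IH].
  rewrite !big_nil; under eq_fun do rewrite scaler0 addr0 subrr mulr0; exact: cvg_cst.
rewrite !big_cons.
have dGi : \forall x \near u, derivable G x (basis_vec i) by apply: filterS dG => x h; exact: h.
have hq := partial_diff_quotient (a := v 0 i) dGi (cG i) (zu r).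
set Z := fun t : R => u + t *: \sum_(j <- r) v 0 j *: basis_vec j in zu hq IH *.
rewrite (_ : (fun t : R => _) = (fun t : R =>
  t^-1 * (G (Z t + (t * v 0 i) *: basis_vec i) - G (Z t)) + t^-1 * (G (Z t) - G u))).
  exact: cvgD hq IH.
apply/funext => t; rewrite -mulrDr /Z addrA subrK scalerDr scalerA.
by rewrite addrA addrAC.
Qed.

End partial_derivatives.

(** * Density of polynomials *)

Section density.
Context {R : realType} {n : nat}.
Local Notation C := (Csmooth R n).
Local Notation V := 'rV[R]_n.+1.
Local Notation "u ** v" := (csmooth_mul u v) (at level 40, left associativity).
Implicit Types (f u v : C) (x : V) (i j : 'I_n.+1) (p : sphere R n).

Lemma near_punctured x : x != 0 -> \forall y \near x, y != 0.
Proof. by move=> x0; apply: open_nbhs_nbhs; split=> //; exact: punctured_open. Qed.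

Transparent tderiv ev.
Lemma ev_tderiv i f p : ev (tderiv i f) p = pderiv i (rext f) (val p).
Proof. by []. Qed.

Lemma ev_rext f p : rext f (val p) = ev f p.
Proof. by rewrite /rext /= radial_proj_val. Qed.
Opaque tderiv ev.

(** The left side is the derivative of the extension of [f] along the position vector,
    and this extension is constant along rays. *)
Lemma euler f : \sum_i xcoord i ** tderiv i f = 0.
Proof.
apply: ev_ext => p; have p0 := sphere_neq0 p; rewrite !evE.
have cG i : {for val p, continuous (pderiv i (rext f))}.
  have /smooth_onP/(_ 1%N) [_ /(_ i) [h _]] := csmooth_smooth f.
  by have [] := h _ p0.
have dG : \forall x \near val p, forall i, derivable (rext f) x (basis_vec i).
  by apply: filterS (near_punctured p0) => x x0 i; exact: derivable_rext.
have := directional_derivative (v := val p) dG cG => h1.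
have h2 : (fun t : R => t^-1 * (rext f (val p + t *: val p) - rext f (val p))) @ (0 : R)^' --> (0 : R).
  have zero0 : (fun=> 0 : R) @ (0 : R)^' --> (0 : R) by exact: cvg_cst.
  apply: cvg_trans zero0; apply: near_eq_cvg.
  have /cvgrPdist_lt/(_ _ (@ltr01 R)) := @dnbhs_cvg0 R; apply: filterS => t.
  rewrite sub0r normrN ltr_norml => /andP[t1 _].
  have -> : rext f (val p + t *: val p) = rext f (val p).
    rewrite -[X in rext f (X + _)]scale1r -scalerDl /rext /= radial_projZ //.
    by rewrite -ltrBlDl sub0r.
  by rewrite subrr mulr0.
rewrite (eq_bigr (fun i => val p 0 i * pderiv i (rext f) (val p))).
  exact: (cvgR_unique h1 h2).
by move=> i _; rewrite evM ev_tderiv ev_coord.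
Qed.

(** The extension of [f] that is positively homogeneous of degree [k].  Unlike [rext f]
    it is regular at the origin, all the more as [k] is large. *)
Definition hext (k : nat) f : V -> R := fun x => enorm x ^+ k * rext f x.

(** A partial derivative of a function homogeneous of degree k is homogeneous of degree
    k - 1.  Here is the function on the sphere that it extends, for [hext k f]. *)
Definition hpartial (k : nat) i f : C := k%:R *: (xcoord i ** f) + tderiv i f.

Lemma hext_sphere k f p : hext k f (val p) = ev f p.
Proof. by rewrite /hext (eqP (valP p)) expr1n mul1r ev_rext. Qed.

Lemma rext_ev f x : rext f x = ev f (radial_proj x).
Proof. by rewrite -ev_rext /rext /= radial_proj_val. Qed.

Lemma rext_bounded f : exists M, forall x, `|rext f x| <= M.
Proof.
have [M hM] := ev_bounded f; exists M => x.
by have := hM (radial_proj x); rewrite -ev_rext /rext /= radial_proj_val.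
Qed.

Lemma is_derive_enorm x i : x != 0 ->
  is_derive x (basis_vec i) (@enorm R n.+1) (rext (xcoord i) x).
Proof.
move=> x0; have [dq eq] := is_derive_sqsum x i.
have := is_derive_comp dq (is_derive1_sqrt (sqsum_gt0 x0)); rewrite eq => -[d1 e1].
apply: DeriveDef => //; apply: (etrans e1).
rewrite -[RHS]/(rext (coordf i) x) rext_coordf // -/(enorm x).
have n0 : enorm x != 0 by rewrite gt_eqF // enorm_gt0.
by move: (enorm x) (x 0 i) n0 => a b a0; field.
Qed.

Lemma pderiv_rext f x i : x != 0 ->
  pderiv i (rext f) x = (enorm x)^-1 * rext (tderiv i f) x.
Proof.
move=> x0; have e0 := enorm_gt0 x0.
have hx : x = enorm x *: val (radial_proj x).
  by rewrite radial_projE // scalerA mulfV ?scale1r // gt_eqF.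
by rewrite {1}hx pderiv_rextZ //; exact: derivable_rext (sphere_neq0 _).
Qed.

Lemma enorm0 : enorm (0 : V) = 0.
Proof. by rewrite /enorm big1 ?sqrtr0 // => j _; rewrite mxE expr0n. Qed.

(** Away from 0 this is the product rule.  At 0 both sides vanish, since [hext k.+1 f] is
    O(|x|^(k+1)) with k > 0. *)
Lemma hext_derive k f i x : (0 < k)%N ->
  is_derive x (basis_vec i) (hext k.+1 f) (hext k (hpartial k.+1 i f) x).
Proof.
move=> k0; have [->|x0] := eqVneq x 0.
  have -> : hext k (hpartial k.+1 i f) 0 = 0.
    by rewrite /hext enorm0 expr0n (gtn_eqF k0) mul0r.
  have [M hM] := rext_bounded f.
  have M0 : 0 <= M by exact: le_trans (normr_ge0 _) (hM 0).
  have hc : t^-1 *: (hext k.+1 f (t *: basis_vec i + 0) - hext k.+1 f 0)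
      @[t --> (0 : R)^'] --> (0 : R).
    apply/cvgrPdist_lt => e e0.
    have e1 : 0 < Num.min 1 (e / (M + 1)) by rewrite lt_min ltr01 divr_gt0 // ltr_wpDl.
    have /cvgrPdist_lt/(_ _ e1) := @dnbhs_cvg0 R.
    move=> ht; apply: filterS2 ht (@near_dnbhs_neq0 R) => t.
    rewrite !sub0r !normrN lt_min => /andP[t1 te] t0.
    rewrite addr0 /hext enorm0.
    rewrite (_ : enorm (t *: basis_vec i) = `|t|); last first.
      rewrite /enorm (bigD1 i) //= big1 ?addr0 => [|j ji].
        by rewrite !mxE !eqxx mulr1 sqrtr_sqr.
      by rewrite !mxE eqxx (negbTE ji) mulr0 expr0n.
    rewrite expr0n /= mul0r subr0 normrM normfV normrM normrX normr_id exprS -mulrA.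
    rewrite mulKf ?normr_eq0 //.
    apply: (@le_lt_trans _ _ (`|t| * M)).
      apply: ler_pM; [exact: exprn_ge0|exact: normr_ge0| |exact: hM].
      by rewrite -[X in _ <= X]expr1; apply: ler_wiXn2l => //; exact: ltW.
    apply: (@le_lt_trans _ _ (`|t| * (M + 1))); first by rewrite ler_wpM2l // lerDl.
    by rewrite -ltr_pdivlMr // ltr_wpDl.
  by apply: DeriveDef; [exact: cvgP hc|exact: (cvg_lim (@norm_hausdorff _ _) hc)].
have d1 := is_derive_enorm i x0.
have d2 : is_derive x (basis_vec i) (rext f) ((enorm x)^-1 * rext (tderiv i f) x).
  by rewrite -pderiv_rext //; apply: DeriveDef => //; exact: derivable_rext.
have d3 : is_derive x (basis_vec i) (fun x => enorm x ^+ k.+1)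
    (k.+1%:R * enorm x ^+ k * rext (xcoord i) x).
  rewrite (_ : (fun x => _) = (@enorm R n.+1) ^+ k.+1).
    exact: (is_deriveX k.+1 d1).
  by apply/funext => y; rewrite exprfctE.
rewrite /hext; apply: is_derive_eq; rewrite -[LHS]/(_ * _ + _ * _).
rewrite /hpartial !rext_ev !evE.
have n0 : enorm x != 0 by rewrite gt_eqF // enorm_gt0.
rewrite exprS; move: (enorm x ^+ k) => ek.
move: (enorm x) (ev _ _) (ev _ _) (ev _ _) n0 => a b c e a0.
by field.
Qed.

Lemma continuous_enorm : continuous (@enorm R n.+1).
Proof.
move=> x; apply: continuous_comp; last exact: sqrt_continuous.
by have [h _] := Ck_sqsum 0 (@openT V); have [] := h x I.
Qed.

Lemma hext_continuous k f : (0 < k)%N -> continuous (hext k f).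
Proof.
move=> k0 x.
have ce : {for x, continuous (fun x : V => enorm x ^+ k)}.
  exact: (continuous_comp (@continuous_enorm x) (@exprn_continuous _ k (enorm x))).
have [x0|x0] := eqVneq x 0; last first.
  change (hext k f @ x --> hext k f x).
  exact: (cvgM ce (@continuous_rext _ _ f x x0)).
have [M hM] := rext_bounded f.
have M1 : 0 < M + 1 by rewrite ltr_wpDl // (le_trans _ (hM 0)).
have z : hext k f x = 0 by rewrite x0 /hext enorm0 expr0n (gtn_eqF k0) mul0r.
suff h : hext k f y @[y --> x] --> (0 : R) by rewrite /continuous_at z; exact: h.
apply: (@cvgrPdist_lt _ _ _ (nbhs x) _ _ _).2 => e e0.
have e1 : 0 < e / (M + 1) by rewrite divr_gt0.
have /cvgrPdist_lt/(_ _ e1) := ce; apply: filterS => y.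
rewrite {1}x0 enorm0 expr0n (gtn_eqF k0) !sub0r !normrN => hy.
rewrite normrM; apply: (@le_lt_trans _ _ (`|enorm y ^+ k| * (M + 1))).
  by apply: ler_wpM2l => //; apply: le_trans (hM y) _; rewrite lerDl.
by rewrite -ltr_pdivlMr.
Qed.

Lemma pderiv_hext k i f : (0 < k)%N ->
  pderiv i (hext k.+1 f) = hext k (hpartial k.+1 i f).
Proof. by move=> k0; apply/funext => x; have [_] := @hext_derive k f i x k0. Qed.

(** Each derivation lowers the degree of homogeneity by 1; continuity at 0 requires a
    positive degree, and differentiability a degree at least 2. *)
Lemma Ck_hext m k f : (m.+1 < k)%N -> Ck m setT (hext k f).
Proof.
elim: m k f => [|m IH] [|k] f //; rewrite ltnS => mk;
  have k0 : (0 < k)%N := leq_ltn_trans (leq0n _) mk;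
  split => //; try (by move=> x _; split; [exact: hext_continuous|
    move=> i; have [] := @hext_derive k f i x k0]).
by move=> i; rewrite pderiv_hext //; exact: IH.
Qed.

End density.

Section polynomial_expressions.
Context {R : realType} {n : nat}.
Local Notation C := (Csmooth R n).
Local Notation V := 'rV[R]_n.+1.
Local Notation "u ** v" := (csmooth_mul u v) (at level 40, left associativity).
Implicit Types (f u v : C) (x y : V) (i j : 'I_n.+1) (p : sphere R n).

(** Expressions rather than functions, since the same polynomial is used on the ambient
    space and on the sphere. *)
Inductive pexpr : Type :=
| PVar of 'I_n.+1
| PCst of R
| PAdd of pexpr & pexpr
| PMul of pexpr & pexpr.

Fixpoint peval (e : pexpr) (x : V) : R :=
  match e with
  | PVar i => x 0 i
  | PCst c => c
  | PAdd a b => peval a x + peval b x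
  | PMul a b => peval a x * peval b x
  end.

Fixpoint pdiff i (e : pexpr) : pexpr :=
  match e with
  | PVar j => PCst (i == j)%:R
  | PCst _ => PCst 0
  | PAdd a b => PAdd (pdiff i a) (pdiff i b)
  | PMul a b => PAdd (PMul a (pdiff i b)) (PMul b (pdiff i a))
  end.

Fixpoint prestr (e : pexpr) : C :=
  match e with
  | PVar i => xcoord i
  | PCst c => csmooth_cst c
  | PAdd a b => prestr a + prestr b
  | PMul a b => prestr a ** prestr b
  end.

Lemma is_derive_peval i e x : is_derive x (basis_vec i) (peval e) (peval (pdiff i e) x).
Proof.
elim: e => [j|c|a IHa b IHb|a IHa b IHb] /=.
- by have := is_derive_coord x (basis_vec i) j; rewrite mxE eqxx /= eq_sym.
- exact: is_derive_cst.
- exact: is_deriveD.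
- exact: is_deriveM.
Qed.

Lemma pderiv_peval i e : pderiv i (peval e) = peval (pdiff i e).
Proof. by apply/funext => x; have [_] := is_derive_peval i e x. Qed.

Lemma ev_prestr e p : ev (prestr e) p = peval e (val p).
Proof.
by elim: e => [j|c|a IHa b IHb|a IHa b IHb] /=; rewrite ?evE ?IHa ?IHb // ev_coord.
Qed.

(** The tangential part of the ambient gradient. *)
Lemma tderiv_prestr i e : tderiv i (prestr e) =
  prestr (pdiff i e) - xcoord i ** \sum_j xcoord j ** prestr (pdiff j e).
Proof.
elim: e => [j|c|a IHa b IHb|a IHa b IHb] /=; apply: ev_ext => p.
- rewrite tderiv_coord !evE; congr (_ - _ * _).
  rewrite -(sum_delta j (fun k => ev (xcoord k) p)); apply: eq_bigr => k _.
  by rewrite !evE mulrC.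
- rewrite tderiv_cst !evE big1 ?mulr0 ?subr0 // => k _.
  by rewrite !evE mulr0.
- rewrite tderivD IHa IHb !evE.
  under [X in _ = _ + _ - _ * X]eq_bigr do rewrite !evE mulrDr.
  rewrite sumrD; under eq_bigr do rewrite !evE.
  under [X in _ + (_ - _ * X) = _]eq_bigr do rewrite !evE.
  by ring.
- rewrite tderivM IHa IHb !evE.
  under [X in _ = _ - _ * X]eq_bigr do rewrite !evE mulrDr
     (mulrCA _ (ev (prestr a) p)) (mulrCA _ (ev (prestr b) p)).
  rewrite sumrD -!mulr_sumr; under eq_bigr do rewrite !evE.
  under [X in _ + _ * (_ - _ * X) = _]eq_bigr do rewrite !evE.
  by ring.
Qed.

Lemma polydeg_prestr e : exists k, polydeg k (prestr e).
Proof.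
elim: e => [j|c|a [k ha] b [l hb]|a [k ha] b [l hb]] /=.
- exists 2; rewrite (_ : xcoord j = xcoord j ** csmooth_cst 1).
    by apply: polydeg_coordM; exact: polydeg_cst.
  by apply: ev_ext => p; rewrite !evE mulr1.
- by exists 1; exact: polydeg_cst.
- have mono r s f : (r <= s)%N -> polydeg r f -> polydeg s f.
    by move=> rs hf; rewrite -(subnK rs); elim: (s - r)%N => // t IH; exact: polydegW.
  exists (maxn k l); apply: polydegD.
    by apply: mono ha; exact: leq_maxl.
  by apply: mono hb; exact: leq_maxr.
- by exists (k + l)%N; exact: polydegM.
Qed.

Lemma bern_pexpr (h : R) w (G : V -> R) y : exists e, peval e = bern h w G y.
Proof.
elim: w y => [|i w IH] y; first by exists (PCst (G y)).
have [a ha] := IH y; have [b hb] := IH (y + h *: basis_vec i).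
pose t := PMul (PAdd (PVar i) (PCst 1)) (PCst 2^-1).
exists (PAdd (PMul (PAdd (PCst 1) (PMul (PCst (-1)) t)) a) (PMul t b)).
by apply/funext => x /=; rewrite ha hb /tau mulN1r.
Qed.

(** Euler's relation for functions homogeneous of degree [k]. *)
Lemma hpartial_sum k f : \sum_j xcoord j ** hpartial k j f = k%:R *: f.
Proof.
apply: ev_ext => p; rewrite !evE.
transitivity (k%:R * ev f p * \sum_j ev (xcoord j) p ^+ 2 +
  ev (\sum_j xcoord j ** tderiv j f) p); last first.
  by rewrite euler sum_coord2 mulr1 ev0 addr0.
rewrite ev_sum mulr_sumr -sumrD; apply: eq_bigr => j _; rewrite /hpartial !evE.
by move: (ev _ _) (ev _ _) (ev _ _) => a b c; ring.
Qed.

Let jcvgB0 k (c d : nat -> C) u v : jcvg \oo k c u -> jcvg \oo k d v ->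
  jcvg \oo k (fun t => c t - d t) (u - v).
Proof.
move=> hc hd; apply: jcvgD hc _; rewrite -scaleN1r.
by under eq_fun do rewrite -scaleN1r; apply: jcvgZ hd; exact: cvg_cst.
Qed.

Let jcvg_sum0 k (c : 'I_n.+1 -> nat -> C) (u : 'I_n.+1 -> C) :
  (forall j, jcvg \oo k (c j) (u j)) ->
  jcvg \oo k (fun t => \sum_j xcoord j ** c j t) (\sum_j xcoord j ** u j).
Proof.
move=> h; elim: (index_enum _) => [|j r IH].
  by rewrite big_nil; under eq_fun do rewrite big_nil; exact: jcvg_cst.
rewrite big_cons; under eq_fun do rewrite big_cons.
by apply: jcvgD IH; apply: jcvgM => //; exact: jcvg_cst.
Qed.

(** Induction on [k].  The partial derivatives of [B N] and of [hext m f] satisfy the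
    hypothesis at order k - 1, so their restrictions converge; by [tderiv_prestr] and
    [hpartial_sum] the tangential derivatives of order one are combinations of them,
    with the coordinates as coefficients. *)
Lemma jcvg_prestr k m f (B : nat -> pexpr) : (k < m)%N ->
  (forall s : seq 'I_n.+1, (size s <= k)%N ->
    ucvg (box 1) \oo (fun N => foldr pderiv (peval (B N)) s)
      (foldr pderiv (hext m f) s)) ->
  jcvg \oo k (fun N => prestr (B N)) f.
Proof.
elim: k m f B => [|k IH] m f B km hB; (split; first (move=> e e0;
  apply: filterS (hB [::] (leq0n _) e e0) => N h p _;
  by have := h _ (enorm1_box (eqP (valP p))); rewrite /= -ev_prestr hext_sphere))
  => //.
case: m km hB => // m; rewrite ltnS => km hB.
have m0 : (0 < m)%N := leq_ltn_trans (leq0n _) km.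
have hj j : jcvg \oo k (fun N => prestr (pdiff j (B N))) (hpartial m.+1 j f).
  apply: (IH m) => // s sk; have := hB (rcons s j); rewrite size_rcons => /(_ sk).
  rewrite foldr_rcons pderiv_hext //.
  by under eq_fun do rewrite foldr_rcons pderiv_peval.
move=> i; under eq_fun do rewrite tderiv_prestr.
rewrite (_ : tderiv i f = hpartial m.+1 i f - xcoord i ** \sum_j xcoord j ** hpartial m.+1 j f).
  by apply: jcvgB0 => //; apply: jcvgM; [exact: jcvg_cst|exact: jcvg_sum0].
rewrite hpartial_sum /hpartial; apply: ev_ext => p; rewrite !evE.
by move: (ev _ _) (ev _ _) (ev _ _) => a b c; ring.
Qed.

(** Closeness of two functions at fixed order and precision, from which the approximations
    at each order are merged into a single sequence. *)
Fixpoint jclose k (e : R) u v : Prop :=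
  (forall p, `|ev u p - ev v p| < e) /\
  if k is k'.+1 then forall i, jclose k' e (tderiv i u) (tderiv i v) else True.

Lemma jcvg_jclose k (c : nat -> C) u : jcvg \oo k c u ->
  forall e, 0 < e -> \forall N \near \oo, jclose k e (c N) u.
Proof.
move=> + e e0; elim: k c u => [|k IH] c u [h1 h2].
  by apply: filterS (h1 e e0) => N h; split=> // p; exact: h.
have h3 : \forall N \near \oo, forall i, jclose k e (tderiv i (c N)) (tderiv i u).
  by apply: filter_forall => i; apply: IH; exact: h2.
by apply: filterS2 (h1 e e0) h3 => N h h'; split=> // p; exact: h.
Qed.

Lemma jclose_le k l (e1 e2 : R) u v : (k <= l)%N -> e1 <= e2 ->
  jclose l e1 u v -> jclose k e2 u v.
Proof.
move=> + e12; elim: k l u v => [|k IH] [|l] u v // kl [h1 h2]; split=> //;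
  try (by move=> p; exact: lt_le_trans (h1 p) e12).
by move=> i; apply: IH (h2 i).
Qed.

Lemma jclose_jcvg k (c : nat -> C) u :
  (forall e, 0 < e -> \forall N \near \oo, jclose k e (c N) u) -> jcvg \oo k c u.
Proof.
elim: k c u => [|k IH] c u h; split=> //; try (by move=> e e0;
  apply: filterS (h e e0) => N [h1 _] p _; exact: h1).
by move=> i; apply: IH => e e0; apply: filterS (h e e0) => N [_ h1]; exact: h1.
Qed.

(** For each [k] the Bernstein polynomials of [hext k.+2 f], which is C^k, approximate [f]
    with its derivatives of order at most [k].  A diagonal choice gives one sequence for
    all orders. *)
Theorem polynomials_dense f :
  exists B : nat -> pexpr, scvg \oo (fun N => prestr (B N)) f.
Proof.
have step1 k : exists B : nat -> pexpr, jcvg \oo k (fun N => prestr (B N)) f.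
  have /choice[B hB] : forall N, exists e, peval e =
      bern (step N) (all_steps N) (hext k.+2 f) (const_mx (-1)) by move=> N; exact: bern_pexpr.
  exists B; apply: (@jcvg_prestr k k.+2) => // s sk.
  under eq_fun do rewrite hB.
  by apply: bernstein_Ck sk; exact: Ck_hext.
have step2 k : exists e, jclose k k.+1%:R^-1 (prestr e) f.
  have [B hB] := step1 k.
  have /(_ k.+1%:R^-1) := jcvg_jclose hB; rewrite invr_gt0 ltr0n => /(_ isT) hN.
  by have [N hN'] := filter_ex hN; exists (B N).
have /choice[B hB] := step2; exists B => m.
apply: jclose_jcvg => e e0.
have /cvgrPdist_lt/(_ _ e0) := @cvg_harmonic R.
have := nbhs_infty_ge m; apply: filterS2 => N mN.
rewrite sub0r normrN => hN; apply: jclose_le (hB N) => //.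
by apply: ltW; exact: le_lt_trans (ler_norm _) hN.
Qed.

End polynomial_expressions.

(** * Absence of scalar constraints *)

Section no_constraint.
Context {R : realType} {n : nat}.
Local Notation C := (Csmooth R n).
Local Notation "u ** v" := (csmooth_mul u v) (at level 40, left associativity).
Implicit Types (u v h : C).

(** The differential of [K] at 0 satisfies the two relations of [l_polydeg], so it vanishes
    on polynomials, and on all functions by density. *)
Lemma Qgen_unconstrained (m : nat) (beta kappa : R) (E : C -> C)
    (a := n%:R / 2 + m%:R) (b := n%:R / 2 - m%:R)
    (Q := Qgen m a beta kappa E) (U : set C) (K : C -> R) :
  admissible m n -> beta != 0 -> a * kappa = beta * Lam m n 1 -> E 0 = 0 ->
  (forall u h, is_dq (fun t => E (u + t *: h)) (csmooth_exp (b *: u) ** h)) ->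
  nbhs (0 : C) U -> submersion_on U K ->
  (\forall u \near (0 : C), K (Q u) = 0) -> False.
Proof.
move=> mn beta0 hk E0 dE nU [oU smK subK] KQ.
have U0 : U 0 by exact: nbhs_singleton nU.
have a0 : a != 0.
  have [m0 n1 _] := mn; rewrite gt_eqF // addr_gt0 ?ltr0n //.
  by rewrite divr_gt0 // ltr0n (ltn_trans _ n1).
have hb : b * Lam m n 1 = a * Lam m n 0 by rewrite mulrC LamS0 mulrC.
have K1 := curve_C1_K smK.
have Q0 : Q 0 = 0.
  rewrite /Q /Qgen E0 paneitz00 !scaler0; apply: ev_ext => p.
  by rewrite !evE expR0 mul1r addr0 subrr.
have dQ0 h : scvg (0 : R)^' (fun t => t^-1 *: Q (t *: h)) (dQgen m a b beta kappa E 0 h).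
  apply: scvg_near (is_dq_Qgen m a beta kappa dE 0 h); apply: filterE => t.
  by rewrite !add0r scale0r -/Q Q0 subr0.
pose l h := gateaux h K 0.
have lD f g : l (f + g) = l f + l g by exact: gateauxD K1 U0.
have lZ (c : R) f : l (c *: f) = c * l f by exact: gateauxZ K1 U0.
have l1 h : l (beta *: paneitz0 m h - (a * kappa) *: h) = 0.
  have := constraint_first_order oU smK Q0 U0 KQ dQ0 h.
  by rewrite dQgen0.
have l2 v h : beta *: paneitz0 m v = (a * kappa) *: v ->
  l ((beta * b) *: paneitz0 m (v ** h) - (a * beta) *: (h ** paneitz0 m v) -
     a *: (v ** (beta *: paneitz0 m h - (a * kappa) *: h))) = 0.
  move=> Pv; have Lv : dQgen m a b beta kappa E 0 v = 0 by rewrite dQgen0 // Pv subrr.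
  have dM (t : R) : scvg (0 : R)^' (fun s => s^-1 *: (Q (t *: v + s *: h) - Q (t *: v)))
      (dQgen m a b beta kappa E (t *: v) h).
    apply: scvg_near (is_dq_Qgen m a beta kappa dE (t *: v) h); apply: filterE => s.
    by rewrite scale0r addr0.
  apply: (constraint_second_order oU smK Q0 U0 KQ dQ0 Lv dM).
  apply: scvg_near (is_dq_dQgen m a beta kappa E0 dE v h); apply: filterE => t.
  by rewrite scale0r.
have [h lh] := subK 0 U0; move/eqP: lh; apply.
have [B hB] := polynomials_dense h.
have hl : l (prestr (B N)) @[N --> \oo] --> l h.
  by apply: (K1.2 _ _ _ (fun=> 0) _ _ _ U0 _ hB); exact: scvg_cst.
apply: (cvgR_unique hl).
have -> : (fun N => l (prestr (B N))) = fun=> 0.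
  apply/funext => N; have [k hk'] := polydeg_prestr (B N).
  exact: (l_polydeg lD lZ mn a0 beta0 hk hb l1 l2 hk').
exact: cvg_cst.
Qed.

Lemma is_dq_expE (b : R) u h : b != 0 ->
  is_dq (fun t => b^-1 *: (csmooth_exp (b *: (u + t *: h)) - csmooth_cst 1))
    (csmooth_exp (b *: u) ** h).
Proof.
move=> b0; have := is_dqZ b^-1 (is_dqD (is_dq_expZ b u h) (is_dq_cst (- csmooth_cst 1))).
by rewrite addr0 scalerA mulVf // scale1r.
Qed.

Lemma paneitz0_cst1 m : paneitz0 m (csmooth_cst 1) = Lam m n 0 *: csmooth_cst 1 :> C.
Proof. by apply: paneitz0_eigen; rewrite laplacian_cst /mu mul0r scale0r. Qed.

Lemma Qincr_critical m u : n = m.*2 ->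
  Qincr m u = Qgen m (n%:R / 2 + m%:R) 1 ((m.*2).-1`!)%:R id u.
Proof.
move=> nm; have nmb : n == m.*2 by apply/eqP.
have -> : n%:R / 2 + m%:R = (m.*2)%:R :> R by rewrite nm -mul2n natrM; field.
by rewrite /Qincr /Qcurv nmb /Qgen scale1r.
Qed.

(** As P_0(e^(b u)) = P_0(e^(b u) - 1) + Lam_0, the constant kappa is Lam_0. *)
Lemma Qincr_noncritical m u (b := n%:R / 2 - m%:R : R) : n != m.*2 -> b != 0 ->
  Qincr m u = Qgen m (n%:R / 2 + m%:R) b (Lam m n 0)
    (fun u => b^-1 *: (csmooth_exp (b *: u) - csmooth_cst 1)) u.
Proof.
move=> nm b0; rewrite /Qincr /Qcurv (negbTE nm) -/b -scalerBr scalerA mulfV // scale1r.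
rewrite /paneitz -/b /Qgen paneitz0Z scalerA mulfV // scale1r.
have e w : csmooth_mul w (csmooth_cst 1) = w :> C by apply: ev_ext => p; rewrite !evE mulr1.
rewrite !e !scaler0.
have -> : csmooth_exp 0 = csmooth_cst 1 :> C by apply: ev_ext => p; rewrite !evE expR0.
have -> : paneitz0 m (csmooth_exp (b *: u) - csmooth_cst 1) =
    paneitz0 m (csmooth_exp (b *: u)) - Lam m n 0 *: csmooth_cst 1.
  by rewrite paneitz0D -scaleN1r paneitz0Z paneitz0_cst1 scaleN1r.
rewrite paneitz0_cst1; apply: ev_ext => p; rewrite !evE.
by move: (expR _) (ev (paneitz0 _ _) _) (Lam _ _ _) => x y z; ring.
Qed.

End no_constraint.

Theorem theorem2 (R : realType) (m n : nat) : admissible m n ->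
  ~ exists (U : set (Csmooth R n)) (K : Csmooth R n -> R),
      [/\ nbhs (0 : Csmooth R n) U,
          submersion_on U K &
          \forall u \near (0 : Csmooth R n),
            U (Qincr m u) /\ K (Qincr m u) = 0].
Proof.
move=> mn [U [K [nU sK near0]]].
have KQ : \forall u \near (0 : Csmooth R n), K (Qincr m u) = 0.
  by apply: filterS near0 => u [].
have [nm|nm] := eqVneq n m.*2.
  apply: (@Qgen_unconstrained R n m 1 ((m.*2).-1`!)%:R id U K mn) => //.
  - rewrite mul1r (Lam1_critical nm) nm.
    have [m0 _ _] := mn.
    have -> : (m.*2)%:R / 2 + m%:R = (m.*2)%:R :> R by rewrite -mul2n natrM; field.
    have : (0 < m.*2)%N by rewrite double_gt0.
    by rewrite -natrM; case: (m.*2) => // k _; rewrite factS.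
  - move=> u h; have := is_dq_line u h.
    rewrite (_ : _ - _ = 0 :> R); last by rewrite nm -mul2n natrM; field.
    rewrite scale0r (_ : csmooth_mul _ _ = h) //.
    by apply: ev_ext => p; rewrite !evE expR0 mul1r.
  - by apply: filterS KQ => u; rewrite Qincr_critical.
have b0 : n%:R / 2 - m%:R != 0 :> R.
  apply: contra nm; rewrite subr_eq0 => /eqP e.
  by rewrite -(eqr_nat R) -mul2n natrM -e; apply/eqP; field.
apply: (@Qgen_unconstrained R n m (n%:R / 2 - m%:R) (Lam m n 0)
  (fun u => (n%:R / 2 - m%:R)^-1 *:
    (csmooth_exp ((n%:R / 2 - m%:R) *: u) - csmooth_cst 1)) U K mn) => //.
- by rewrite mulrC -LamS0 mulrC.
- rewrite scaler0 (_ : csmooth_exp 0 = csmooth_cst 1) ?subrr ?scaler0 //.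
  by apply: ev_ext => p; rewrite !evE expR0.
- by move=> u h; exact: is_dq_expE.
- by apply: filterS KQ => u; rewrite Qincr_noncritical.
Qed.
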